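(* Let $(R,\mathfrak m)$ be a Cohen-Macaulay local ring of dimension $d\ge2$ with infinite residue field, $I$ an $\mathfrak m$-primary ideal, and $\mathcal I=\{I_n\}$ an $I$-admissible filtration. If $e_2(\mathcal I)=0$, then $\operatorname{depth}G(\mathcal I)\ne d-1$.
   Context: $\lambda(-)$ denotes length. A sequence of ideals $\mathcal I=\{I_n\}_{n\in\mathbb Z}$ is an $I$-admissible filtration if for all $n,m\in\mathbb Z$: $I_{n+1}\subseteq I_n$; $I_mI_n\subseteq I_{m+n}$; and there is $k\in\mathbb N$ with $I^n\subseteq I_n\subseteq I^{n-k}$ for all $n$ (with $I^n=R$ for $n\le0$). The Hilbert coefficients $e_0(\mathcal I),\dots,e_d(\mathcal I)$ are the integers with $\lambda(R/I_n)=\sum_{i=0}^d(-1)^ie_i(\mathcal I)\binom{n+d-1-i}{d-i}$ for all $n\gg0$. $G(\mathcal I)=\bigoplus_{n\ge0}I_n/I_{n+1}$, with depth taken with respect to its unique maximal homogeneous ideal. *)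

(* Defs.v *)
From HB Require Import structures.
From mathcomp Require Import all_boot all_order all_algebra.
From mathcomp Require Import boolp classical_sets cardinality.

Set Implicit Arguments.
Unset Strict Implicit.
Unset Printing Implicit Defensive.

Import Order.TTheory GRing.Theory Num.Theory.

Local Open Scope classical_set_scope.
Local Open Scope ring_scope.
Local Open Scope quotient_scope.

Definition is_max (S : set nat) (n : nat) := S n /\ ubound S n.

(** [n] counts the strict inclusions c 0 < c 1 < ... < c n. *)
Definition chain_of_length (T : Type) (P : set (set T)) (n : nat) : Prop :=
  exists c : nat -> set T,
    (forall i, (i <= n)%N -> P (c i)) /\
    (forall i, (i < n)%N -> c i `<` c i.+1).

(** ** Ideals *)

Section Ideals.
Variable A : comPzRingType.
Implicit Types (I J P : set A).

Definition is_ideal I : Prop :=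
  [/\ I 0, (forall x y, I x -> I y -> I (x + y))
    & (forall a x, I x -> I (a * x))].

Definition prime_ideal P : Prop :=
  [/\ is_ideal P, P <> setT & forall x y, P (x * y) -> P x \/ P y].

Definition maximal_ideal P : Prop :=
  [/\ is_ideal P, P <> setT
    & forall J, is_ideal J -> P `<=` J -> J = P \/ J = setT].

Definition primary_ideal I : Prop :=
  [/\ is_ideal I, I <> setT
    & forall x y, I (x * y) -> I x \/ exists n, I (y ^+ n)].

Definition radical I : set A := [set x | exists n, I (x ^+ n)].

Definition gen_ideal (S : set A) : set A := smallest is_ideal S.

Definition mul_ideal I J : set A :=
  gen_ideal [set z | exists x y, [/\ I x, J y & z = x * y]].

Definition exp_ideal I (n : nat) : set A := iter n (mul_ideal I) setT.

Definition expz_ideal I (n : int) : set A :=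
  if n is Posz k then exp_ideal I k else setT.

(** The condition for [i] says that s_i is a nonzerodivisor on
    A/(s_0, ..., s_{i-1}). *)
Definition regular_sequence (s : seq A) : Prop :=
  (forall i y, (i < size s)%N ->
     gen_ideal [set` take i s] (s`_i * y) -> gen_ideal [set` take i s] y) /\
  gen_ideal [set` s] <> setT.

(** The depth of the ring [A] with respect to the ideal [J] is [r]. *)
Definition has_depth J (r : nat) : Prop :=
  is_max [set n | exists s : seq A,
            [/\ regular_sequence s, [set` s] `<=` J & size s = n]] r.

End Ideals.

Definition noetherian (A : comPzRingType) : Prop :=
  forall J : set A, is_ideal J -> exists s : seq A, J = gen_ideal [set` s].

Definition has_krull_dim (A : comPzRingType) (d : nat) : Prop :=
  is_max (chain_of_length (@prime_ideal A)) d.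

Definition local_ring (A : comPzRingType) (m : set A) : Prop :=
  maximal_ideal m /\ forall m', maximal_ideal m' -> m' = m.

Definition cohen_macaulay_local (A : comPzRingType) (m : set A) : Prop :=
  [/\ noetherian A, local_ring m
    & exists2 d, has_krull_dim A d & has_depth m d].

(** ** Quotients by ideals, as rings and as modules.
    MathComp's [{ideal_quot _}] only treats proper ideals. *)

Record ideal (A : comPzRingType) := Ideal {
  ideal_set :> A -> Prop;
  idealP : is_ideal ideal_set }.

Section Quotient.
Variables (A : comPzRingType) (I : ideal A).

Definition ideal_pred : {pred A} := fun x => `[< I x >].

Lemma ideal_predP x : reflect (I x) (x \in ideal_pred).
Proof. exact: asboolP. Qed.

Lemma ideal_pred_zmod : zmod_closed ideal_pred.
Proof.
have [I0 ID IM] := idealP I; split; first exact/ideal_predP.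
move=> x y /ideal_predP Ix /ideal_predP Iy; apply/ideal_predP/ID => //.
by rewrite -mulN1r; apply: IM.
Qed.

HB.instance Definition _ := GRing.isZmodClosed.Build A ideal_pred ideal_pred_zmod.

Lemma ideal_predM a x : x \in ideal_pred -> a * x \in ideal_pred.
Proof.
by have [_ _ IM] := idealP I; move=> /ideal_predP Ix; apply/ideal_predP/IM.
Qed.

Definition qring := Quotient.quot ideal_pred.
HB.instance Definition _ := Choice.on qring.
HB.instance Definition _ := GRing.Zmodule.on qring.
HB.instance Definition _ := EqQuotient.on qring.
HB.instance Definition _ := ZmodQuotient.on qring.

Definition qpi (x : A) : qring := \pi_qring x.

Lemma qpi_eq x y : qpi x = qpi y <-> I (x - y).
Proof.
rewrite /qpi; split.
  by move=> /eqP; rewrite -Quotient.idealrBE => /ideal_predP.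
by move=> /ideal_predP; rewrite Quotient.idealrBE => /eqP.
Qed.

Lemma qpi_repr (x : qring) : qpi (repr x) = x.
Proof. exact: reprK. Qed.

Lemma qpiB : {morph qpi : x y / x - y}.
Proof. by move=> x y; rewrite /qpi raddfB. Qed.

Lemma qpiD : {morph qpi : x y / x + y}.
Proof. by move=> x y; rewrite /qpi raddfD. Qed.

Definition qmul (x y : qring) : qring := qpi (repr x * repr y).
Definition qscale (a : A) (x : qring) : qring := qpi (a * repr x).

Lemma repr_qpi x : I (repr (qpi x) - x).
Proof. by apply/qpi_eq; rewrite qpi_repr. Qed.

Lemma qpiM x y : qpi (x * y) = qmul (qpi x) (qpi y).
Proof.
have [_ ID IM] := idealP I.
apply/esym/qpi_eq; set x' := repr _; set y' := repr _.
have -> : x' * y' - x * y = x' * (y' - y) + y * (x' - x).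
  by rewrite !mulrBr addrA [y * x']mulrC subrK [y * x]mulrC.
by apply: ID; apply: IM; apply: repr_qpi.
Qed.

Lemma qpiZ a x : qpi (a * x) = qscale a (qpi x).
Proof.
have [_ ID IM] := idealP I.
by apply/esym/qpi_eq; rewrite -mulrBr; apply/IM/repr_qpi.
Qed.

Lemma qmulA : associative qmul.
Proof.
move=> x y z; rewrite -[x]qpi_repr -[y]qpi_repr -[z]qpi_repr.
by rewrite -!qpiM mulrA.
Qed.

Lemma qmulC : commutative qmul.
Proof. by move=> x y; rewrite /qmul mulrC. Qed.

Lemma qmul1 : left_id (qpi 1) qmul.
Proof. by move=> x; rewrite -[x]qpi_repr -qpiM mul1r. Qed.

Lemma qmulDl : left_distributive qmul +%R.
Proof.
move=> x y z; rewrite -[x]qpi_repr -[y]qpi_repr -[z]qpi_repr.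
by rewrite -qpiD -!qpiM -qpiD mulrDl.
Qed.

HB.instance Definition _ :=
  GRing.Zmodule_isComPzRing.Build qring qmulA qmulC qmul1 qmulDl.

Lemma qscaleA a b x : qscale a (qscale b x) = qscale (a * b) x.
Proof. by rewrite -[x]qpi_repr -!qpiZ mulrA. Qed.

Lemma qscale1 : left_id 1 qscale.
Proof. by move=> x; rewrite -[x]qpi_repr -qpiZ mul1r. Qed.

Lemma qscaleDr : right_distributive qscale +%R.
Proof.
move=> a x y; rewrite -[x]qpi_repr -[y]qpi_repr.
by rewrite -qpiD -!qpiZ -qpiD mulrDr.
Qed.

Lemma qscaleDl x : {morph qscale^~ x : a b / a + b}.
Proof. by move=> a b; rewrite -[x]qpi_repr -!qpiZ -qpiD mulrDl. Qed.

HB.instance Definition _ :=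
  GRing.Zmodule_isLmodule.Build A qring qscaleA qscale1 qscaleDr qscaleDl.

End Quotient.

(** ** Length of a module *)

Definition is_submodule (A : pzRingType) (M : lmodType A) (N : set M) : Prop :=
  [/\ N 0, (forall x y, N x -> N y -> N (x + y))
    & (forall (a : A) x, N x -> N (a *: x))].

Definition has_length (A : pzRingType) (M : lmodType A) (n : nat) : Prop :=
  is_max (chain_of_length (@is_submodule A M)) n.

(** ** Filtrations and their Hilbert coefficients *)

Record admissible_filtration (R : comPzRingType) (I : set R) := Filtration {
  fil :> int -> ideal R;
  fil_decr : forall n : int, fil (n + 1) `<=` fil n;
  fil_mul : forall m n : int, mul_ideal (fil m) (fil n) `<=` fil (m + n);
  fil_adm : exists k : nat, forall n : int,
    expz_ideal I n `<=` fil n /\ fil n `<=` expz_ideal I (n - k%:Z) }.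

(** Only the values e 0, ..., e d are constrained. *)
Definition hilbert_coefficients (R : comPzRingType) (I : set R)
    (F : admissible_filtration I) (d : nat) (e : nat -> int) : Prop :=
  exists N : nat, forall n : nat, (N <= n)%N ->
    exists2 l : nat, has_length (qring (F n%:Z) : lmodType R) l
      & l%:Z = \sum_(i < d.+1)
                 (-1) ^+ i * e i * ('C(n + d - 1 - i, d - i))%:Z.

(** ** The associated graded ring
    It is realized as (\bigoplus_n I_n t^n) / (\bigoplus_n I_{n+1} t^n), where
    the numerator is a subring of the polynomial ring R[t]. *)

Section AssociatedGraded.
Variables (R : comNzRingType) (I : set R) (F : admissible_filtration I).

Definition rees_pred : {pred {poly R}} :=
  fun p : {poly R} => `[< forall i : nat, F i%:Z p`_i >].

Lemma rees_predP (p : {poly R}) : reflect (forall i : nat, F i%:Z p`_i) (p \in rees_pred).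
Proof. exact: asboolP. Qed.

Lemma fil_mulr m n x y : F m x -> F n y -> F (m + n) (x * y).
Proof.
by move=> Fx Fy; apply: fil_mul => J [_]; apply; exists x, y.
Qed.

Lemma fil_sum n (T : Type) (s : seq T) (P : pred T) (f : T -> R) :
  (forall i, P i -> F n (f i)) -> F n (\sum_(i <- s | P i) f i).
Proof. by have [F0 FD _] := idealP (F n); apply: (big_ind (F n)). Qed.

Lemma fil0_full x : F 0 x.
Proof. by have [k /(_ 0) [+ _]] := fil_adm F; apply. Qed.

Lemma rees_subring : subring_closed rees_pred.
Proof.
split.
- apply/rees_predP => -[|i]; first exact: fil0_full.
  by rewrite coef1; have [] := idealP (F i.+1).
- move=> p q /rees_predP Fp /rees_predP Fq; apply/rees_predP => i.
  have [_ FD FM] := idealP (F i); rewrite coefB; apply: FD => //.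
  by rewrite -mulN1r; apply: FM.
- move=> p q /rees_predP Fp /rees_predP Fq; apply/rees_predP => i.
  rewrite coefM; apply: fil_sum => j _.
  by rewrite -{1}(subnKC (ltnSE (ltn_ord j))) PoszD; apply: fil_mulr.
Qed.

HB.instance Definition _ :=
  GRing.isSubringClosed.Build {poly R} rees_pred rees_subring.

Record rees := Rees { rees_val :> {poly R}; _ : rees_val \in rees_pred }.
HB.instance Definition _ := [isSub for rees_val].
HB.instance Definition _ := [Choice of rees by <:].
HB.instance Definition _ := [SubChoice_isSubComNzRing of rees by <:].

Lemma reesP (p : rees) (i : nat) : F i%:Z (rees_val p)`_i.
Proof. by apply/rees_predP; apply: valP. Qed.

Definition rees_shift : set rees :=
  [set p : rees | forall i : nat, F (i%:Z + 1) (rees_val p)`_i].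

Lemma rees_shift_ideal : is_ideal rees_shift.
Proof.
split=> [i|p q Fp Fq i|a p Fp i].
- by rewrite coef0; have [] := idealP (F (i%:Z + 1)).
- by have [_ FD _] := idealP (F (i%:Z + 1)); rewrite coefD; apply: FD.
- rewrite coefM; apply: fil_sum => j _.
  rewrite -{1}(subnKC (ltnSE (ltn_ord j))) PoszD -addrA.
  by apply: fil_mulr; [apply: reesP | apply: Fp].
Qed.

Definition assoc_graded := qring (Ideal rees_shift_ideal).
HB.instance Definition _ := GRing.ComPzRing.on assoc_graded.

Definition gr_class (p : rees) : assoc_graded := qpi _ p.

(** The summand I_n / I_{n+1}. *)
Definition gr_component (n : nat) : set assoc_graded :=
  [set gr_class p | p in [set p : rees | forall i, i != n -> (rees_val p)`_i = 0]].

Definition homogeneous_ideal (J : set assoc_graded) : Prop :=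
  is_ideal J /\ J = gen_ideal (J `&` \bigcup_n gr_component n).

Definition maximal_homogeneous_ideal (M : set assoc_graded) : Prop :=
  [/\ homogeneous_ideal M, M <> setT
    & forall J, homogeneous_ideal J -> M `<=` J -> J = M \/ J = setT].

(** For an [m]-primary ideal [I] there is exactly one such ideal, namely
    m/I_1 (+) I_1/I_2 (+) I_2/I_3 (+) ... *)

Definition gr_max (m : set R) : set assoc_graded :=
  [set gr_class p | p in [set p : rees | m (rees_val p)`_0]].

Lemma gr_classD p q : gr_class (p + q) = gr_class p + gr_class q.
Proof. exact: qpiD. Qed.

Lemma gr_classM p q : gr_class (p * q) = gr_class p * gr_class q.
Proof. exact: qpiM. Qed.

Lemma gr_class0 : gr_class 0 = 0.
Proof. by apply: (addrI (gr_class 0)); rewrite -gr_classD !addr0. Qed.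

Lemma gr_class_eq p q : gr_class p = gr_class q <-> rees_shift (p - q).
Proof. exact: (qpi_eq (Ideal rees_shift_ideal)). Qed.

Lemma gr_class_surj (x : assoc_graded) : exists p, x = gr_class p.
Proof. by exists (repr x); rewrite /gr_class qpi_repr. Qed.

Lemma rees_monoP n (r : R) : F n%:Z r -> (r *: 'X^n) \in rees_pred.
Proof.
move=> Fr; apply/rees_predP => i; rewrite coefZ coefXn.
have [->|_] := eqVneq i n; first by rewrite mulr1.
by rewrite mulr0; have [] := idealP (F i).
Qed.

Definition rees_mono n (r : R) (Fr : F n%:Z r) : rees := Rees (rees_monoP Fr).

Lemma rees_mono_component n r (Fr : F n%:Z r) :
  gr_component n (gr_class (rees_mono Fr)).
Proof.
by exists (rees_mono Fr) => //= i /negPf ni; rewrite coefZ coefXn ni mulr0.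
Qed.

Definition rees_const (r : R) : rees := rees_mono (fil0_full r).

Lemma rees_val_inj : injective rees_val. Proof. exact: val_inj. Qed.

Lemma rees_sum (p : rees) :
  p = \sum_(i < size (rees_val p)) rees_mono (reesP p i).
Proof.
apply: rees_val_inj; rewrite (big_morph rees_val (fun _ _ => erefl) (erefl _)) /=.
by rewrite -[LHS]coefK poly_def.
Qed.

Lemma gr_class_sum n (f : 'I_n -> rees) :
  gr_class (\sum_(i < n) f i) = \sum_(i < n) gr_class (f i).
Proof. exact: (big_morph _ gr_classD gr_class0). Qed.

Lemma ideal_of_fil1 (m : set R) : radical I = m -> primary_ideal I ->
  F 1 `<=` m.
Proof.
move=> <- [[I0 ID IM] _ _] x Fx; have [k Fk] := fil_adm F; exists k.+1.
have Fxn n : F n%:Z (x ^+ n).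
  elim: n => [|n IHn]; first exact: fil0_full.
  by rewrite exprS -add1n PoszD; apply: fil_mulr.
have /= := (Fk k.+1).2 _ (Fxn k.+1).
rewrite -addn1 PoszD addrAC subrr add0r; apply; split => //.
by move=> _ [a [b [Ia _ ->]]]; rewrite mulrC; apply: IM.
Qed.

Lemma fil1_of_ideal x : I x -> F 1 x.
Proof.
move=> Ix; have [k Fk] := fil_adm F.
apply: (Fk 1%N%:Z).1 => J [_]; apply.
by exists x, 1; rewrite mulr1.
Qed.

Lemma gen_ideal_ideal (A : comPzRingType) (S : set A) : is_ideal (gen_ideal S).
Proof.
split=> [J [[] //]|x y Sx Sy J JS|a x Sx J JS]; have [[J0 JD JM] _] := JS.
  by apply: JD; [apply: Sx | apply: Sy].
by apply: JM; apply: Sx.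
Qed.

Lemma ideal_sum (A : comPzRingType) (J : set A) n (f : 'I_n -> A) :
  is_ideal J -> (forall i, J (f i)) -> J (\sum_(i < n) f i).
Proof. by move=> [J0 JD _] Jf; apply: (big_ind J). Qed.

Lemma ideal_full (A : comPzRingType) (J : set A) : is_ideal J -> J 1 -> J = setT.
Proof.
by move=> [_ _ JM] J1; apply/seteqP; split=> // x _; rewrite -[x]mulr1; apply: JM.
Qed.

Section MaximalHomogeneous.
Variable m : set R.
Hypotheses (mmax : maximal_ideal m) (Iprim : primary_ideal I).
Hypothesis (Im : radical I = m).

Let m_ideal : is_ideal m. Proof. by have [] := mmax. Qed.
Let m1 : ~ m 1.
Proof. by have [mi mT _] := mmax; move=> /(ideal_full mi). Qed.

Lemma gr_max_homogeneous : homogeneous_ideal (gr_max m).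
Proof.
have [m0 mD mM] := m_ideal.
have gi : is_ideal (gr_max m).
  split.
  - by exists 0; [rewrite /= coef0 | exact: gr_class0].
  - move=> _ _ [p mp <-] [q mq <-]; exists (p + q); last exact: gr_classD.
    by rewrite /= coefD; apply: mD.
  - move=> a _ [p mp <-]; have [b ->] := gr_class_surj a.
    exists (b * p); last exact: gr_classM.
    by rewrite /= coef0M; apply: mM.
split=> //; apply/seteqP; split; last first.
  by move=> x; apply; split=> // y [].
move=> _ [p mp <-]; rewrite [p in gr_class p]rees_sum gr_class_sum.
apply: ideal_sum; first exact: gen_ideal_ideal.
move=> i J [_]; apply; split; last by exists i => //; apply: rees_mono_component.
exists (rees_mono (reesP p i)) => //=.
rewrite coefZ coefXn; have [<-|_] := eqVneq 0%N (val i); first by rewrite mulr1.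
by rewrite mulr0.
Qed.

Lemma gr_max_proper : gr_max m <> setT.
Proof.
have [m0 mD mM] := m_ideal.
move=> mT; have [p /= mp p1] : gr_max m (gr_class 1) by rewrite mT.
have /gr_class_eq/(_ 0%N) := p1; rewrite /= coefB coef1 add0r /=.
move=> /(ideal_of_fil1 Im Iprim) mp1; apply: m1.
have -> : 1 = (rees_val p)`_0 + (-1) * ((rees_val p)`_0 - 1).
  by rewrite mulN1r opprB addrCA subrr addr0.
by apply: mD => //; apply: mM.
Qed.

Lemma rees_constD x y :
  rees_const (x + y) = rees_const x + rees_const y.
Proof. by apply: rees_val_inj => /=; rewrite scalerDl. Qed.

Lemma rees_constM x y : rees_const (x * y) = rees_const x * rees_const y.
Proof. by apply: rees_val_inj => /=; rewrite expr0 !alg_polyC polyCM. Qed.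

Lemma homogeneous_sub_gr_max (J : set assoc_graded) :
  homogeneous_ideal J -> J <> setT -> J `<=` gr_max m.
Proof.
move=> [Jid Jgen] JT; have [J0 JD JM] := Jid.
have [m0 mD mM] := m_ideal.
pose J1 := [set r : R | J (gr_class (rees_const r))].
have const0 : rees_const 0 = 0 by apply: rees_val_inj => /=; rewrite scale0r.
have J1id : is_ideal J1.
  split; rewrite /J1 /=.
  - by rewrite const0 gr_class0.
  - by move=> x y Jx Jy; rewrite rees_constD gr_classD; apply: JD.
  - by move=> a x Jx; rewrite rees_constM gr_classM; apply: JM.
have [_ J1D J1M] := J1id.
have J11 : ~ J1 1.
  rewrite /J1 /= => J1'; apply: JT; apply: (ideal_full Jid).
  suff -> : 1 = gr_class (rees_const 1) by [].
  have -> : rees_const 1 = 1 by apply: rees_val_inj; rewrite /= scale1r expr0.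
  by [].
have IJ1 : I `<=` J1.
  move=> x Ix; rewrite /J1 /=; suff -> : gr_class (rees_const x) = gr_class 0.
    by rewrite gr_class0.
  apply/gr_class_eq => i; rewrite subr0 /= coefZ coefXn.
  case: i => [|i] /=; first by rewrite mulr1 add0r; apply: fil1_of_ideal.
  by rewrite mulr0; have [] := idealP (F (i.+1%:Z + 1)).
pose K := [set x : R | exists a b, [/\ m a, J1 b & x = a + b]].
have Kid : is_ideal K.
  split.
  - by exists 0, 0; split=> //; [have [] := J1id | rewrite addr0].
  - move=> _ _ [a [b [ma Jb ->]]] [a' [b' [ma' Jb' ->]]].
    by exists (a + a'), (b + b'); split; [apply: mD|apply: J1D|rewrite addrACA].
  - move=> c _ [a [b [ma Jb ->]]].
    by exists (c * a), (c * b); split; [apply: mM|apply: J1M|rewrite mulrDr].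
have K1 : ~ K 1.
  move=> [a [b [ma Jb ab]]]; move: (ma); rewrite -Im => -[n /IJ1 Jan].
  apply: J11; suff [c] : exists c, 1 = a ^+ n + c * b.
    by move=> ->; apply: J1D => //; apply: J1M.
  elim: n {Jan} => [|n [c IHn]]; first by exists 0; rewrite mul0r addr0.
  exists (c * a + 1); rewrite mulrDl mul1r exprSr addrA [c * a * b]mulrAC -mulrDl.
  by rewrite -IHn mul1r.
have mK : m `<=` K.
  by move=> a ma; exists a, 0; split=> //; [have [] := J1id | rewrite addr0].
have J1m : J1 `<=` m.
  have [_ _ /(_ K Kid mK)] := mmax; case=> [<- b Jb | KT].
    by exists 0, b; split=> //; rewrite add0r.
  by case: K1; rewrite KT.
pose L := [set x | exists2 p, x = gr_class p & J1 (rees_val p)`_0].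
have Lid : is_ideal L.
  split.
  - by exists 0; [rewrite gr_class0 | rewrite coef0; have [] := J1id].
  - move=> _ _ [p -> Jp] [q -> Jq]; exists (p + q); first by rewrite gr_classD.
    by rewrite coefD; apply: J1D.
  - move=> a _ [p -> Jp]; have [b ->] := gr_class_surj a.
    by exists (b * p); [rewrite gr_classM | rewrite coef0M; apply: J1M].
rewrite Jgen => x /(_ L) []; last by move=> p -> /J1m mp; exists p.
split=> // y [Jy [n _ [p pn py]]]; exists p => //.
case: n pn => [|n] /= pn; last by rewrite pn //; have [] := J1id.
rewrite /J1 /=; suff -> : rees_const (rees_val p)`_0 = p by rewrite py.
apply: rees_val_inj => /=; apply/polyP => -[|i].
  by rewrite coefZ coefXn mulr1.
by rewrite coefZ coefXn mulr0 pn.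
Qed.

Lemma maximal_homogeneousP (M : set assoc_graded) :
  maximal_homogeneous_ideal M <-> M = gr_max m.
Proof.
split=> [[Mh MT Mmax]|->].
  have Mm := homogeneous_sub_gr_max Mh MT.
  by have [//|/gr_max_proper] := Mmax _ gr_max_homogeneous Mm.
split; [exact: gr_max_homogeneous|exact: gr_max_proper|].
move=> J Jh mJ; have [->|JT] := pselect (J = setT); first by right.
by left; apply/seteqP; split=> //; apply: homogeneous_sub_gr_max.
Qed.

End MaximalHomogeneous.

End AssociatedGraded.

(* Main.v *)
Require Import Defs.
From mathcomp Require Import all_boot all_order all_algebra.
From mathcomp Require Import boolp classical_sets functions cardinality.
From mathcomp Require Import zify ring.

(** Pick [x_1, ..., x_(d-1)] in [I_1] whose degree-one forms are a regular sequence on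
    [G] and which are regular on [R]; the infinite residue field allows this without
    homogeneous prime avoidance, and depth drops by exactly one at each
    step because modulo two regular elements the socles correspond. Each step takes the
    backward difference of the Hilbert function, so modulo [K = (x_1, ..., x_(d-1))] the
    function [L n = length (R/(I_n + K))] sums to [e_0 binom(n+1, 2) - e_1 n + e_2].
    With [x] regular modulo [K] and [I_(n+1) + K = x I_n + K] for large [n], one has
    [L (n+1) = L n + e_0 - v_n] with [v_n = length ((I_(n+1) + K)/(x I_n + K))]. Hence
    [w_n = L n - e_0 n + e_1] is nonincreasing and eventually zero, and
    [e_2 = sum_(n >= 1) w_n]. If [e_2 = 0], every [w_n] and so every [v_n] with
    [n >= 1] vanishes, and the form of [x] is regular modulo the initial ideal of [K]:
    a regular sequence of length [d] on [G]. *)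

Set Implicit Arguments.
Unset Strict Implicit.
Unset Printing Implicit Defensive.

Import Order.TTheory GRing.Theory Num.Theory.

Local Open Scope classical_set_scope.
Local Open Scope ring_scope.

(** Quotients are represented by ideals of two fixed rings: [R/K] by [K], and the quotient of [G] by
    the initial forms of [K] by an ideal of the Rees algebra. No filtration is ever transported to a
    quotient ring. The price is the ascending chain condition on the Rees algebra, which comes from
    the upper bound [I_n <= I^(n-k)]. [G] need not be generated in degree one. Forms of degree one
    still suffice, because [I_(n+1)] lies in [I I_n] for large [n], so that a prime containing them
    contains all forms of positive degree. The obstacle is the last step: modulo the initial forms
    of [K] the graded ring may have depth zero, and no form is known to be regular there. But its
    socle lives in bounded degrees, so [x] can be chosen to act injectively in high degrees.
    Equality of lengths and Nakayama then give [I_(n+1) + K = x I_n + K] for large [n], and only the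
    numerical argument extends this to every [n >= 1]. *)

Section IdealArith.
Variable A : comPzRingType.
Implicit Types (I J K P E V X : set A) (x y : A).

Lemma ideal0 I : is_ideal I -> I 0. Proof. by case. Qed.

Lemma ideal_add I x y : is_ideal I -> I x -> I y -> I (x + y).
Proof. by case=> _ + _; apply. Qed.

Lemma ideal_mull I x y : is_ideal I -> I y -> I (x * y).
Proof. by case=> _ _; apply. Qed.

Lemma ideal_mulr I x y : is_ideal I -> I x -> I (x * y).
Proof. by rewrite mulrC; apply: ideal_mull. Qed.

Lemma ideal_sub I x y : is_ideal I -> I x -> I y -> I (x - y).
Proof. by move=> hI Ix Iy; apply: ideal_add => //; rewrite -mulN1r; apply: ideal_mull. Qed.

Lemma ideal_subl I x y : is_ideal I -> I y -> I (x - y) -> I x.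
Proof. by move=> hI Iy Ixy; rewrite -[x](subrK y); apply: ideal_add. Qed.

Lemma is_idealT : is_ideal [set: A].
Proof. by []. Qed.

Lemma gen_idealP (S : set A) : is_ideal (gen_ideal S).
Proof. exact: gen_ideal_ideal. Qed.

Lemma sub_gen_ideal (S : set A) : S `<=` gen_ideal S.
Proof. by move=> x Sx J [_]; apply. Qed.

Lemma gen_ideal_min (S : set A) J : is_ideal J -> S `<=` J -> gen_ideal S `<=` J.
Proof. by move=> hJ SJ x; apply. Qed.

Lemma gen_idealS (S S' : set A) : S `<=` S' -> gen_ideal S `<=` gen_ideal S'.
Proof.
by move=> SS; apply: gen_ideal_min (gen_idealP _) _ => x /SS; apply: sub_gen_ideal.
Qed.

Definition add_ideal I J : set A := [set z | exists a b, [/\ I a, J b & z = a + b]].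

Definition add_scaled I x J : set A :=
  [set z | exists a b, [/\ I a, J b & z = a + x * b]].

Definition adjoin I x : set A := add_scaled I x setT.

Definition colon I x : set A := [set y | I (x * y)].

Lemma add_idealP I J : is_ideal I -> is_ideal J -> is_ideal (add_ideal I J).
Proof.
move=> hI hJ; split.
- by exists 0, 0; split; [exact: ideal0|exact: ideal0|rewrite addr0].
- move=> _ _ [a [b [Ia Jb ->]]] [a' [b' [Ia' Jb' ->]]].
  by exists (a + a'), (b + b'); split; [exact: ideal_add|exact: ideal_add|ring].
- move=> c _ [a [b [Ia Jb ->]]].
  by exists (c * a), (c * b); split; [exact: ideal_mull|exact: ideal_mull|ring].
Qed.

Lemma add_idealSl I J : is_ideal J -> I `<=` add_ideal I J.
Proof. by move=> hJ x Ix; exists x, 0; split; [|exact: ideal0|rewrite addr0]. Qed.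

Lemma add_idealSr I J : is_ideal I -> J `<=` add_ideal I J.
Proof. by move=> hI x Jx; exists 0, x; split; [exact: ideal0| |rewrite add0r]. Qed.

Lemma add_scaledP I x J : is_ideal I -> is_ideal J -> is_ideal (add_scaled I x J).
Proof.
move=> hI hJ; split.
- by exists 0, 0; split; [exact: ideal0|exact: ideal0|rewrite mulr0 addr0].
- move=> _ _ [a [b [Ia Jb ->]]] [a' [b' [Ia' Jb' ->]]].
  by exists (a + a'), (b + b'); split; [exact: ideal_add|exact: ideal_add|ring].
- move=> c _ [a [b [Ia Jb ->]]].
  by exists (c * a), (c * b); split; [exact: ideal_mull|exact: ideal_mull|ring].
Qed.

Lemma add_scaledSl I x J : is_ideal J -> I `<=` add_scaled I x J.
Proof.
by move=> hJ y Iy; exists y, 0; split; [|exact: ideal0|rewrite mulr0 addr0].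
Qed.

Lemma add_scaledM I x J y : is_ideal I -> J y -> add_scaled I x J (x * y).
Proof. by move=> hI Jy; exists 0, y; split; [exact: ideal0| |rewrite add0r]. Qed.

Lemma adjoinP I x : is_ideal I -> is_ideal (adjoin I x).
Proof. by move=> hI; apply: add_scaledP. Qed.

Lemma adjoinS I x : I `<=` adjoin I x.
Proof. exact: add_scaledSl. Qed.

Lemma adjoinC I x y : adjoin (adjoin I x) y = adjoin (adjoin I y) x.
Proof.
suff H u v : adjoin (adjoin I u) v `<=` adjoin (adjoin I v) u.
  by apply/seteqP; split; apply: H.
move=> _ [_ [c [[a [b [Ia _ ->]]] _ ->]]].
exists (a + v * c), b; split=> //; last by ring.
by exists a, c.
Qed.

Lemma colonP I x : is_ideal I -> is_ideal (colon I x).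
Proof.
move=> hI; split; rewrite /colon /=.
- by rewrite mulr0; apply: ideal0.
- by move=> y z Iy Iz; rewrite mulrDr; apply: ideal_add.
- by move=> c y Iy; rewrite mulrCA; apply: ideal_mull.
Qed.

Lemma gen_ideal_nil : gen_ideal [set` [::] : seq A] = [set 0 : A].
Proof.
apply/seteqP; split; last by move=> _ ->; apply: ideal0 (gen_idealP _).
apply: gen_ideal_min => //; split=> //=.
  by move=> _ _ -> ->; rewrite addr0.
by move=> a _ ->; rewrite mulr0.
Qed.

Lemma gen_ideal_rcons (s : seq A) x :
  gen_ideal [set` rcons s x] = adjoin (gen_ideal [set` s]) x.
Proof.
apply/seteqP; split.
  apply: gen_ideal_min; first exact/adjoinP/gen_idealP.
  move=> y /=; rewrite mem_rcons inE => /predU1P[->|ys].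
    by exists 0, 1; split; [exact: ideal0 (gen_idealP _)| |rewrite mulr1 add0r].
  by apply: adjoinS; apply: sub_gen_ideal.
move=> _ [a [b [sa _ ->]]]; have hg := gen_idealP [set` rcons s x].
apply: (ideal_add hg); last first.
  by apply: (ideal_mulr _ hg); apply: sub_gen_ideal; rewrite /= mem_rcons mem_head.
by apply: (gen_idealS _ sa) => y /= ys; rewrite mem_rcons inE ys orbT.
Qed.

End IdealArith.

(** ** Chain conditions *)

Definition acc (T : Type) (P : set T -> Prop) : Prop :=
  forall c : nat -> set T, (forall j, P (c j)) -> (forall j, c j `<=` c j.+1) ->
  exists j0, forall j, (j0 <= j)%N -> c j = c j0.

Lemma chain_subset (T : Type) (c : nat -> set T) :
  (forall j, c j `<=` c j.+1) -> forall i j, (i <= j)%N -> c i `<=` c j.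
Proof.
move=> cS i j /subnK <-; elim: (j - i)%N => [//|k IHk].
by rewrite addSn; apply: subset_trans IHk (cS _).
Qed.

Lemma acc_max (T : Type) (P Q : set T -> Prop) : acc P ->
  (forall J, Q J -> P J) -> (exists J, Q J) ->
  exists2 J, Q J & forall J', Q J' -> J `<=` J' -> J' = J.
Proof.
move=> hP QP [J0 QJ0]; apply: contrapT => nmax.
have next J : exists J', Q J -> [/\ Q J', J `<=` J' & J' <> J].
  have [QJ|nQJ] := pselect (Q J); last by exists J.
  apply: contrapT => nJ; apply: nmax; exists J => // J' QJ' JJ'.
  by apply: contrapT => ne; apply: nJ; exists J'.
have [f fP] := choice next; pose c n := iter n f J0.
have Qc n : Q (c n) by elim: n => //= n IHn; have [] := fP _ IHn.
have [j cj] : exists j0, forall j, (j0 <= j)%N -> c j = c j0.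
  by apply: hP => n; [exact: QP|have [] := fP _ (Qc n)].
by have [_ _] := fP _ (Qc j); apply; rewrite -[f _]/(c j.+1) cj.
Qed.

Lemma noetherian_acc (A : comPzRingType) : noetherian A -> acc (@is_ideal A).
Proof.
move=> nA c hc cS; pose U : set A := \bigcup_j c j.
have cle := chain_subset cS.
have hU : is_ideal U.
  split.
  - by exists 0%N => //; apply: ideal0.
  - move=> x y [i _ ix] [j _ jy]; exists (maxn i j) => //.
    by apply: ideal_add => //; [apply: cle ix|apply: cle jy]; rewrite ?leq_maxl ?leq_maxr.
  - by move=> a x [i _ ix]; exists i => //; apply: ideal_mull.
have [s Us] := nA _ hU.
have [j0 sj0] : exists j0, [set` s] `<=` c j0.
  have : [set` s] `<=` U by rewrite Us; apply: sub_gen_ideal.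
  elim: s {Us} => [|x s IHs] sU; first by exists 0%N.
  have [j1 j1s] : exists j0, [set` s] `<=` c j0.
    by apply: IHs => y ys; apply: sU; rewrite /= inE ys orbT.
  have [j2 _ j2x] := sU x (mem_head _ _).
  exists (maxn j1 j2) => y /=; rewrite inE => /predU1P[->|ys].
    by apply: cle j2x; rewrite leq_maxr.
  by apply: cle (j1s _ ys); rewrite leq_maxl.
exists j0 => j j0j; apply/seteqP; split; last exact: cle.
apply: (@subset_trans _ U); first by move=> x ?; exists j.
by rewrite Us; apply: gen_ideal_min.
Qed.

(** ** Associated primes and prime avoidance *)

Section Avoidance.
Variable A : comPzRingType.
Implicit Types (I J P E V X N : set A).

(* Kaplansky's argument: if the maximal annihilators are attained at [a_1, a_2, ...],
   the ideal generated by the [a_i] is generated by finitely many of them, and then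
   the intersection of the corresponding annihilators lies in every other one. *)
Lemma maximal_annihilators I E : acc (@is_ideal A) -> is_ideal I ->
    (forall x y, E x -> E (x * y)) ->
  exists s : seq A, (forall a, a \in s -> [/\ E a, ~ I a & prime_ideal (colon I a)]) /\
    (forall a, E a -> ~ I a -> exists2 b, b \in s & colon I a `<=` colon I b).
Proof.
move=> hA hI hE.
pose mx a := [/\ E a, ~ I a &
  forall b, E b -> ~ I b -> colon I a `<=` colon I b -> colon I b = colon I a].
have mx_above a : E a -> ~ I a -> exists2 b, mx b & colon I a `<=` colon I b.
  move=> Ea Ia.
  pose Q J := exists b, [/\ E b, ~ I b, colon I a `<=` colon I b & J = colon I b].
  have [J [b [Eb Ib ab ->]] Jmax] : exists2 J, Q J & forall J', Q J' -> J `<=` J' -> J' = J.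
    apply: (acc_max hA); last by exists (colon I a), a; split.
    by move=> _ [b [_ _ _ ->]]; apply: colonP.
  exists b => //; split=> // b' Eb' Ib' bb'; apply: Jmax => //.
  by exists b'; split=> //; apply: subset_trans bb'.
have mx_prime a : mx a -> prime_ideal (colon I a).
  move=> [Ea Ia amax]; split; first exact: colonP.
    by move=> /seteqP[_ /(_ 1 Logic.I)]; rewrite /colon /= mulr1.
  move=> x y axy; have [ax|ax] := pselect (colon I a x); first by left.
  right; have <- : colon I (a * x) = colon I a.
    apply: amax => //; first exact: hE.
    by move=> z az; rewrite /colon /= mulrAC; apply: ideal_mulr.
  by rewrite /colon /= -mulrA.
pose Q J := exists2 s : seq A, (forall a, a \in s -> mx a) & J = gen_ideal [set` s].
have [_ [s smx ->] Jmax] : exists2 J, Q J & forall J', Q J' -> J `<=` J' -> J' = J.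
  apply: (acc_max hA); last by exists (gen_ideal [set` [::]]), [::].
  by move=> _ [s _ ->]; apply: gen_idealP.
exists s; split=> [a /smx mxa|a Ea Ia].
  by split; [case: mxa|case: mxa|exact: mx_prime].
have [b mxb ab] := mx_above a Ea Ia; suff [c cs cb] : exists2 c, c \in s & colon I c `<=` colon I b.
  exists c => //; have [Ec Ic /(_ b)] := smx _ cs; case: (mxb) => Eb Ib _.
  by move=> <-.
apply: contrapT => nc.
have [_ _ bprime] := mx_prime _ mxb.
have [y by_ sy] : exists2 y, ~ colon I b y & forall c, c \in s -> colon I c y.
  have: {subset s <= s} by [].
  elim: {-2}s => [|c s' IHs] ss'.
    by exists 1 => //; rewrite /colon /= mulr1; case: mxb.
  have [y by_ s'y] : exists2 y, ~ colon I b y & forall c, c \in s' -> colon I c y.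
    by apply: IHs => z zs'; apply: ss'; rewrite inE zs' orbT.
  have [z bz cz] : exists2 z, ~ colon I b z & colon I c z.
    apply: contrapT => nz; apply: nc; exists c; first exact: ss' (mem_head _ _).
    by move=> z cz; apply: contrapT => bz; apply: nz; exists z.
  exists (y * z); first by move=> /bprime[].
  move=> c'; rewrite inE => /predU1P[->|c's']; first by apply: ideal_mull; [exact: colonP|].
  by apply: ideal_mulr; [exact: colonP|exact: s'y].
apply: by_; suff : gen_ideal [set` s] `<=` colon I y.
  rewrite /colon /= mulrC; apply.
  suff <- : gen_ideal [set` rcons s b] = gen_ideal [set` s].
    by apply: sub_gen_ideal; rewrite /= mem_rcons mem_head.
  apply: Jmax; last by apply: gen_idealS => z /= zs; rewrite mem_rcons inE zs orbT.
  by exists (rcons s b) => // c; rewrite mem_rcons inE => /predU1P[->|/smx].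
by apply: gen_ideal_min; [exact: colonP|move=> c /sy; rewrite /colon /= mulrC].
Qed.

(** Finite unions of ideals none of which contains [V]. Keeping the union as a set lets bad loci of
    different origin be merged by [thin_setU]. *)
Inductive thin V : set A -> Prop :=
| thin0 : thin V set0
| thinU X N : thin V X -> is_ideal N -> ~ V `<=` N -> thin V (X `|` N).

Lemma thin_setU V X Y : thin V X -> thin V Y -> thin V (X `|` Y).
Proof.
move=> hX; elim=> [|Y' N _ IH hN VN]; first by rewrite setU0.
by rewrite setUA; apply: thinU.
Qed.

Lemma thin_seq (T : eqType) V (s : seq T) (N : T -> set A) :
  (forall a, a \in s -> is_ideal (N a) /\ ~ V `<=` N a) ->
  exists2 X, thin V X & forall a, a \in s -> N a `<=` X.
Proof.
elim: s => [|a s IHs] sN; first by exists set0 => //; apply: thin0.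
have [|X hX sX] := IHs; first by move=> b bs; apply: sN; rewrite inE bs orbT.
have [hNa Va] := sN a (mem_head _ _); exists (X `|` N a); first exact: thinU.
move=> b; rewrite inE => /predU1P[->|/sX bX] x; first by right.
by move=> /bX; left.
Qed.

Lemma thin_pigeonhole V X (f : nat -> A) n0 : thin V X ->
  (forall i, (n0 <= i)%N -> X (f i)) ->
  exists N i j, [/\ is_ideal N, N `<=` X, i <> j, N (f i) & N (f j)].
Proof.
move=> hX; elim: hX n0 => [n0 /(_ n0 (leqnn _)) //|Y N hY IH hN VN n0 Xf].
have [[i [ni Nfi]]|nN] := pselect (exists i, (n0 <= i)%N /\ N (f i)); last first.
  have [|M [i [j [hM MY ij Mi Mj]]]] := IH n0.
    by move=> i ni; have [//|Nfi] := Xf i ni; case: nN; exists i.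
  by exists M, i, j; split=> // x /MY; left.
have [[j [ij Nfj]]|nN] := pselect (exists j, (i < j)%N /\ N (f j)).
  exists N, i, j; split=> //.
  by move=> eij; rewrite eij ltnn in ij.
have [|M [i' [j [hM MY ij Mi Mj]]]] := IH i.+1.
  move=> j ij; have [//|Nfj] := Xf j (leq_trans ni (ltnW ij)).
  by case: nN; exists j.
by exists M, i', j; split=> // x /MY; left.
Qed.

Definition unit_differences (u : nat -> A) : Prop :=
  forall i j, i <> j -> exists c, c * (u i - u j) = 1.

(* A module over a ring with infinitely many elements whose differences are units is
   not a finite union of proper submodules; no primality is involved. *)
Lemma avoid_thin u V X : unit_differences u -> is_ideal V -> thin V X ->
  exists2 x, V x & ~ X x.
Proof.
move=> hu hV; elim=> [|Y N hY [x Vx Yx] hN VN].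
  by exists 0 => //; apply: ideal0.
have [Nx|Nx] := pselect (N x); last by exists x => // -[].
have [w Vw Nw] : exists2 w, V w & ~ N w.
  by apply: contrapT => nw; apply: VN => w Vw; apply: contrapT => Nw; apply: nw; exists w.
apply: contrapT => nall.
(* The whole line [w + u i * x] misses [N], which contains [x] but not [w]. If it stayed in [Y], two
   of its points would share an ideal inside [Y], and their difference, a unit times [x], would put
   [x] in [Y]. *)
have [|M [i [j [hM MY ij Mi Mj]]]] := @thin_pigeonhole V Y (fun i => w + u i * x) 0 hY.
  move=> i _; apply: contrapT => Yi; apply: nall; exists (w + u i * x).
    by apply: ideal_add => //; apply: ideal_mull.
  move=> [//|Ni]; apply: Nw; rewrite -[w](addrK (u i * x)).
  by apply: ideal_sub => //; apply: ideal_mull.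
apply: Yx; apply: MY; have [c c1] := hu _ _ ij.
rewrite -[x]mul1r -c1 -mulrA; apply: ideal_mull => //.
have -> : (u i - u j) * x = (w + u i * x) - (w + u j * x) by ring.
exact: ideal_sub.
Qed.

End Avoidance.

(** ** Regular sequences modulo an ideal *)

Section RegularDepth.
Variables (A : comPzRingType) (M : set A).
Implicit Types (I J : set A).

Definition nzd_mod I (f : A) : Prop := forall y, I (f * y) -> I y.

(** Positive depth in elementwise form: [A/I] has no nonzero element killed by [M]. *)
Definition socle_free I : Prop := forall a, (forall f, M f -> I (f * a)) -> I a.

(** Properness of the final ideal is left out here; [depth_ge_regular_sequence] recovers it from
    [M <> setT]. *)
Fixpoint depth_ge I (r : nat) : Prop :=
  if r is r'.+1 then exists f, [/\ M f, nzd_mod I f & depth_ge (adjoin I f) r'] else True.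

Lemma depth_ge_socle_free I r : depth_ge I r.+1 -> socle_free I.
Proof. by move=> [f [Mf fI _]] a Ma; apply/fI/Ma. Qed.

(** The half of the permutability of a regular pair that is valid over every ring: in
    [f y = a + g z] one cancels [g], then [f], without Nakayama. *)
Lemma nzd_mod_swap I f g : is_ideal I ->
  nzd_mod I f -> nzd_mod (adjoin I f) g -> nzd_mod (adjoin I g) f.
Proof.
move=> hI fI gI y [a [z [Ia _ fy]]].
have [b [w [Ib _ ez]]] : adjoin I f z.
  apply: gI; exists (- a), y; split=> //; last by rewrite fy; ring.
  by rewrite -sub0r; apply: (ideal_sub hI) => //; apply: ideal0.
exists (y - g * w), w; split=> //; last by ring.
apply: fI; have -> : f * (y - g * w) = a + g * b by rewrite mulrBr fy ez; ring.
by apply: (ideal_add hI) => //; apply: ideal_mull.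
Qed.

(* For [f] and [g] regular modulo [I], multiplication matches the socles of
   [A/(I + fA)] and [A/(I + gA)]: if [M a] lies in [I + fA] and [g a = f b] mod [I],
   then [M b] lies in [I + gA]. *)
Lemma socle_free_exchange I f g : is_ideal I -> M f -> M g ->
  nzd_mod I f -> nzd_mod I g -> socle_free (adjoin I g) -> socle_free (adjoin I f).
Proof.
move=> hI Mf Mg fI gI sg a Ma.
have [c [b [Ic _ gab]]] := Ma g Mg.
have [c' [b' [Ic' _ eb]]] : adjoin I g b.
  apply: sg => h Mh; have [c' [d [Ic' _ had]]] := Ma h Mh.
  exists (h * b - g * d), d; split=> //; last by ring.
  apply: fI; have -> : f * (h * b - g * d) = g * c' - h * c.
    have -> : f * (h * b - g * d) = h * (f * b) - g * (f * d) by ring.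
    have -> : f * b = g * a - c by rewrite gab; ring.
    have -> : f * d = h * a - c' by rewrite had; ring.
    by ring.
  by apply: (ideal_sub hI); apply: ideal_mull.
exists (a - f * b'), b'; split=> //; last by ring.
apply: gI; have -> : g * (a - f * b') = c + f * c'.
  by rewrite mulrBr gab eb; ring.
by apply: (ideal_add hI) => //; apply: ideal_mull.
Qed.

Hypothesis hA : acc (@is_ideal A).

(** Every zerodivisor modulo [I] lies in one of finitely many maximal annihilators [colon I a]; if
    one of these contained [M], then [a] would be a nonzero socle element. *)
Lemma thin_zerodivisors I : is_ideal I -> socle_free I ->
  exists2 X, thin M X & forall f, ~ X f -> nzd_mod I f.
Proof.
move=> hI sI.
have [s [sP sE]] := @maximal_annihilators A I setT hA hI (fun _ _ _ => Logic.I).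
have [|X hX sX] := @thin_seq A A M s (colon I).
  move=> a /sP[_ Ia _]; split; first exact: colonP.
  by move=> Ma; apply: Ia; apply: sI => f /Ma; rewrite /colon /= mulrC.
exists X => // f Xf y Ify; apply: contrapT => Iy.
have [b bs yb] := sE y Logic.I Iy; apply: Xf; apply: (sX b bs); apply: yb.
by rewrite /colon /= mulrC.
Qed.

Variable u : nat -> A.
Hypotheses (hu : unit_differences u) (hM : is_ideal M).

(** The first element [g] of the given sequence and [f] are linked by a generic [h], regular modulo
    [I], [I + fA] and [I + gA]. The induction hypothesis is applied to [h] modulo [I + gA], then to
    [f] modulo [I + hA]. *)
Lemma depth_ge_exchange r I f : is_ideal I -> depth_ge I r.+1 -> M f -> nzd_mod I f ->
  depth_ge (adjoin I f) r.
Proof.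
elim: r I f => [//|r IHr] I f hI Idepth Mf fI.
have sI := depth_ge_socle_free Idepth.
move: Idepth => [g [Mg gI gdepth]].
have sg := depth_ge_socle_free gdepth.
have sf := socle_free_exchange hI Mf Mg fI gI sg.
have [X0 tX0 X0P] := thin_zerodivisors hI sI.
have [Xf tXf XfP] := thin_zerodivisors (adjoinP f hI) sf.
have [Xg tXg XgP] := thin_zerodivisors (adjoinP g hI) sg.
have [h Mh nh] := avoid_thin hu hM (thin_setU tX0 (thin_setU tXf tXg)).
have hX0 : nzd_mod I h by apply: X0P => Xh; apply: nh; left.
have hXf : nzd_mod (adjoin I f) h by apply: XfP => Xh; apply: nh; right; left.
have hXg : nzd_mod (adjoin I g) h by apply: XgP => Xh; apply: nh; right; right.
exists h; split=> //; rewrite adjoinC; apply: (IHr _ f) => //; first exact: adjoinP.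
  exists g; split=> //; first exact: nzd_mod_swap.
  by rewrite adjoinC; apply: IHr => //; apply: adjoinP.
exact: nzd_mod_swap.
Qed.

End RegularDepth.

Section RegularSequences.
Variables (A : comPzRingType) (M : set A).

Lemma regular_sequence_depth_ge (s : seq A) : regular_sequence s -> [set` s] `<=` M ->
  depth_ge M [set 0] (size s).
Proof.
move=> [sreg _] sM; rewrite -gen_ideal_nil -[[::]](take0 s) -[X in depth_ge _ _ X]subn0.
have: (0 <= size s)%N by []; move: 0%N => i.
move: {2}(size s - i)%N (erefl (size s - i)%N) => k; elim: k i => [|k IHk] i ek le_i.
  by rewrite ek.
have lt_i : (i < size s)%N by lia.
rewrite ek /=; exists (s`_i); split; first by apply: sM; apply: mem_nth.
  by move=> y; apply: sreg.
rewrite -gen_ideal_rcons -take_nth //.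
have e : (size s - i.+1)%N = k by lia.
by rewrite -e; apply: IHk.
Qed.

Lemma depth_ge_regular_sequence r : is_ideal M -> M <> setT -> depth_ge M [set 0] r ->
  exists s : seq A, [/\ regular_sequence s, [set` s] `<=` M & size s = r].
Proof.
move=> hM MT.
suff H (t : seq A) : depth_ge M (gen_ideal [set` t]) r -> [set` t] `<=` M ->
    exists s, [/\ size s = (size t + r)%N, [set` s] `<=` M, take (size t) s = t &
      forall i y, (size t <= i < size s)%N ->
        gen_ideal [set` take i s] (s`_i * y) -> gen_ideal [set` take i s] y].
  rewrite -gen_ideal_nil => /H[//|s [ss sM _ sreg]]; exists s; split=> //.
  split; first by move=> i y lt_i; apply: sreg.
  move=> gT; apply: MT; apply/seteqP; split=> // x _.
  have sx : gen_ideal [set` s] x by rewrite gT.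
  exact: (gen_ideal_min hM sM) sx.
elim: r t => [|r IHr] t /= tdepth tM.
  exists t; split=> //; rewrite ?addn0 ?take_size //.
  by move=> i y /andP[le_i /(leq_ltn_trans le_i)]; rewrite ltnn.
have [f [Mf ft]] := tdepth; rewrite -gen_ideal_rcons => /IHr[|s [ss sM st sreg]].
  by move=> x /=; rewrite mem_rcons inE => /predU1P[->|/tM].
move: ss st sreg; rewrite size_rcons => ss st sreg.
have tt : take (size t) s = t.
  have := congr1 (take (size t)) st; rewrite take_takel //.
  by rewrite -cats1 take_size_cat.
exists s; split=> //; first by rewrite ss addSnnS.
move=> i y /andP[]; rewrite leq_eqVlt => /predU1P[<-|lt_i] ilt; last first.
  by apply: sreg; rewrite lt_i.
have -> : s`_(size t) = f.
  have := congr1 (fun s => s`_(size t)) st; rewrite nth_take // => ->.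
  by rewrite nth_rcons ltnn eqxx.
by rewrite tt; apply: ft.
Qed.

End RegularSequences.

(** ** Local rings *)

Section Local.
Variables (R : comPzRingType) (m : set R).
Hypotheses (hR : acc (@is_ideal R)) (hm : local_ring m).

Lemma local_ideal : is_ideal m. Proof. by case: hm => -[]. Qed.

Lemma local_invertible x : ~ m x -> exists c, c * x = 1.
Proof.
move=> mx; apply: contrapT => nx.
pose Q J := [/\ is_ideal J, ~ J 1 & J x].
have [J [hJ J1 Jx] Jmax] : exists2 J, Q J & forall J', Q J' -> J `<=` J' -> J' = J.
  apply: (acc_max hR); first by move=> J [].
  exists (adjoin [set 0] x); have h0 : is_ideal [set 0 : R].
    by rewrite -gen_ideal_nil; apply: gen_idealP.
  split; first exact: adjoinP.
    by move=> [_ [c [-> _]]]; rewrite add0r mulrC => c1; apply: nx; exists c.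
  by exists 0, 1; split=> //; rewrite add0r mulr1.
apply: mx; suff <- : J = m by [].
have [_ mloc] := hm; apply: mloc; split=> //.
  by move=> JT; apply: J1; rewrite JT.
move=> J' hJ' JJ'; have [J'1|J'1] := pselect (J' 1).
  by right; apply: ideal_full.
by left; apply: Jmax => //; split=> //; apply: JJ'.
Qed.

Lemma local_1sub a : m a -> exists c, c * (1 - a) = 1.
Proof.
move=> ma; apply: local_invertible => m1; have [[hI mT _] _] := hm.
apply: mT; apply: (ideal_full hI); rewrite -(subrK a 1).
exact: (ideal_add hI).
Qed.

(** The hypothesis encodes [E <= B + mE], with the sum replaced by all ideals [C] containing it. A
    maximal [C] between [B] and [E] that misses part of [E] contains every product [a y]: otherwise
    [y] lies in [C + (a y)], and a unit [1 - a b] brings [y] into [C]. *)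
Lemma nakayama (B E : set R) : is_ideal B -> is_ideal E -> B `<=` E ->
  (forall C, is_ideal C -> B `<=` C -> (forall a y, m a -> E y -> C (a * y)) -> E `<=` C) ->
  E `<=` B.
Proof.
move=> hB hE BE EmE; apply: contrapT => EB.
pose Q C := [/\ is_ideal C, B `<=` C, C `<=` E & ~ E `<=` C].
have [C [hC BC CE EC] Cmax] : exists2 J, Q J & forall J', Q J' -> J `<=` J' -> J' = J.
  by apply: (acc_max hR); [move=> J []|exists B; split].
apply: EC; apply: EmE => // a y ma Ey; apply: contrapT => Cay.
have [c [b [Cc _ ey]]] : adjoin C (a * y) y.
  apply: contrapT => ny; apply: Cay.
  suff <- : adjoin C (a * y) = C by exists 0, 1; split=> //; [apply: ideal0|rewrite add0r mulr1].
  apply: Cmax; last exact: adjoinS.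
  split; first exact: adjoinP.
  - by apply: subset_trans BC _; apply: adjoinS.
  - move=> _ [c [b [Cc _ ->]]]; apply: (ideal_add hE); first exact: CE.
    by rewrite mulrAC; apply: ideal_mull.
  - by move=> /(_ _ Ey).
have [d d1] := local_1sub (@ideal_mulr _ m a b local_ideal ma).
apply: Cay; apply: (ideal_mull _ hC); rewrite -[y]mul1r -d1 -mulrA; apply: (ideal_mull _ hC).
suff -> : (1 - a * b) * y = c by [].
by rewrite mulrBl mul1r {1}ey; ring.
Qed.

End Local.

Lemma residue_units (R : comPzRingType) (m : ideal R) :
  acc (@is_ideal R) -> local_ring m -> infinite_set [set: qring m] ->
  exists u : nat -> R, unit_differences u.
Proof.
move=> hR hm /infiniteP/card_leP[f].
pose g (i : nat) : qring m := val (f (SigSub (mem_set (Logic.I : [set: nat] i)))).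
exists (fun i => repr (g i)) => i j ij.
apply: (local_invertible hR hm) => mij; apply: ij.
have: g i = g j by rewrite -[g i]qpi_repr -[g j]qpi_repr; apply/qpi_eq.
by move=> /val_inj /(@inj _ _ _ f); rewrite !inE => /(_ Logic.I Logic.I) [].
Qed.

(** ** Noetherianity of the Rees algebra of a filtration *)

Section HilbertBasis.
Variable U : comNzRingType.
Implicit Types (O N W : set U) (u : U).

(** Submodules over the subring generated by [O], without constructing that subring. *)
Definition stable_under O W : Prop :=
  [/\ W 0, (forall x y, W x -> W y -> W (x - y)) & (forall o x, O o -> W x -> W (o * x))].

Definition acc_under O N : Prop := acc (fun W => stable_under O W /\ W `<=` N).

(** The module [N[u]] inside [U]. Since [u] may satisfy relations over [N], an element does not
    determine its coefficients. *)
Definition power_span N u : set U :=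
  [set z | exists n (f : nat -> U), (forall i, N (f i)) /\ z = \sum_(i < n) f i * u ^+ i].

Lemma stableN O W x : stable_under O W -> W x -> W (- x).
Proof. by move=> [W0 WB _] Wx; rewrite -sub0r; apply: WB. Qed.

Lemma stableD O W x y : stable_under O W -> W x -> W y -> W (x + y).
Proof.
move=> hW Wx Wy; rewrite -[y]opprK; have [_ WB _] := hW.
by apply: WB => //; apply: stableN hW Wy.
Qed.

Lemma power_spanS N O u : stable_under O N -> N `<=` power_span N u.
Proof.
move=> _ x Nx; exists 1%N, (fun=> x); split=> //.
by rewrite big_ord1 expr0 mulr1.
Qed.

Lemma power_span_pad N O u n k (f : nat -> U) : stable_under O N ->
    (forall i, N (f i)) -> (n <= k)%N -> exists g : nat -> U, (forall i, N (g i)) /\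
  \sum_(i < n) f i * u ^+ i = \sum_(i < k) g i * u ^+ i.
Proof.
move=> [N0 _ _] Nf nk; exists (fun i => if (i < n)%N then f i else 0); split.
  by move=> i; case: ifP.
rewrite (big_ord_widen k (fun i => f i * u ^+ i) nk) [RHS](bigID (fun i : 'I_k => (i < n)%N)) /=.
rewrite [X in _ = _ + X]big1 ?addr0; last by move=> i /negPf->; rewrite mul0r.
by apply: eq_bigr => i ->.
Qed.

Lemma power_span_stable N O u : stable_under O N ->
  stable_under (u |` O) (power_span N u).
Proof.
move=> hN; have [N0 NB NO] := hN; split.
- by apply: power_spanS hN _ _.
- move=> _ _ [n [f [Nf ->]]] [k [g [Ng ->]]].
  have [f' [Nf' ->]] := power_span_pad u hN Nf (leq_maxl n k).
  have [g' [Ng' ->]] := power_span_pad u hN Ng (leq_maxr n k).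
  exists (maxn n k), (fun i => f' i - g' i); split; first by move=> i; apply: NB.
  by rewrite -sumrB; apply: eq_bigr => i _; rewrite mulrBl.
- move=> o _ [->|Oo] [n [f [Nf ->]]].
    exists n.+1, (fun i => if i is i'.+1 then f i' else 0); split; first by case.
    rewrite big_ord_recl mul0r add0r mulr_sumr; apply: eq_bigr => i _.
    by rewrite lift0 exprS; ring.
  exists n, (fun i => o * f i); split; first by move=> i; apply: NO.
  by rewrite mulr_sumr; apply: eq_bigr => i _; rewrite mulrA.
Qed.

Section LeadingCoefficients.
Variables (O N : set U) (u : U).
Hypothesis hN : stable_under O N.

(** Expressions in powers of [u] are not unique, so leading coefficients are collected over all
    expressions of elements of [W]. *)
Definition lead_coefs n W : set U := [set a | N a /\ exists f : nat -> U,
  (forall i, N (f i)) /\ W (a * u ^+ n + \sum_(i < n) f i * u ^+ i)].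

Lemma lead_coefs_stable n W : stable_under O W -> stable_under O (lead_coefs n W).
Proof.
move=> [W0 WB WO]; have [N0 NB NO] := hN; split.
- split=> //; exists (fun=> 0); split=> //.
  by rewrite mul0r add0r big1 // => i _; rewrite mul0r.
- move=> x y [Nx [f [Nf Wf]]] [Ny [g [Ng Wg]]]; split; first exact: NB.
  exists (fun i => f i - g i); split; first by move=> i; apply: NB.
  have := WB _ _ Wf Wg; congr W; rewrite mulrBl.
  under [in RHS]eq_bigr do rewrite mulrBl.
  by rewrite sumrB; ring.
- move=> o x Oo [Nx [f [Nf Wf]]]; split; first exact: NO.
  exists (fun i => o * f i); split; first by move=> i; apply: NO.
  have := WO _ _ Oo Wf; congr W; rewrite mulrDr mulrA mulr_sumr; congr (_ + _).
  by apply: eq_bigr => i _; rewrite mulrA.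
Qed.

Lemma lead_coefsS n W : (forall x, W x -> W (u * x)) ->
  lead_coefs n W `<=` lead_coefs n.+1 W.
Proof.
move=> Wu a [Na [f [Nf Wf]]]; have [N0 _ _] := hN; split=> //.
exists (fun i => if i is i'.+1 then f i' else 0); split; first by case.
have := Wu _ Wf; congr W; rewrite mulrDr mulr_sumr big_ord_recl mul0r add0r exprS.
congr (_ + _); first by ring.
by apply: eq_bigr => i _; rewrite lift0 exprS; ring.
Qed.

Lemma lead_coefs_mono n W W' : W `<=` W' -> lead_coefs n W `<=` lead_coefs n W'.
Proof. by move=> WW' a [Na [f [Nf Wf]]]; split=> //; exists f; split=> //; apply: WW'. Qed.

(** Subtracting an element of [W] that has an expression with the same leading coefficient shortens
    the expression, down to the empty sum. *)
Lemma lead_coefs_inj W W' : stable_under O W -> stable_under O W' ->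
  W `<=` W' -> W' `<=` power_span N u ->
  (forall n, lead_coefs n W' `<=` lead_coefs n W) -> W' `<=` W.
Proof.
move=> hW hW' WW' W'N le x W'x; have [n [f [Nf ex]]] := W'N _ W'x.
move: W'x; rewrite ex {x ex}; have [_ NB _] := hN; have [_ WB' _] := hW'.
elim: n f Nf => [|n IHn] f Nf W'f; first by rewrite big_ord0; case: hW.
move: W'f; rewrite big_ord_recr /= => W'f.
have [_ [g [Ng Wg]]] : lead_coefs n W (f n).
  by apply: le; split=> //; exists f; split=> //; rewrite addrC.
have W'fg := WB' _ _ W'f (WW' _ Wg).
have -> : \sum_(i < n) f i * u ^+ i + f n * u ^+ n =
   \sum_(i < n) (f i - g i) * u ^+ i + (f n * u ^+ n + \sum_(i < n) g i * u ^+ i).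
  under [X in _ = X + _]eq_bigr do rewrite mulrBl.
  by rewrite sumrB; ring.
apply: (stableD hW) => //; apply: (IHn (fun i => f i - g i)) => [i|].
  exact: NB.
move: W'fg; congr W'; under [in RHS]eq_bigr do rewrite mulrBl.
by rewrite sumrB; ring.
Qed.

End LeadingCoefficients.

(** Hilbert's basis theorem for modules, relative to the operators [O]. *)
Lemma acc_under_power_span N O u : stable_under O N -> acc_under O N ->
  acc_under (u |` O) (power_span N u).
Proof.
move=> hN aN c hc cS; pose L n j := lead_coefs N u n (c j).
have sO W : stable_under (u |` O) W -> stable_under O W.
  by move=> [? ? WO]; split=> // o x Oo; apply: WO; right.
have cst j : stable_under O (c j) by apply: sO; case: (hc j).
have cle := chain_subset cS.
have LP n j : stable_under O (L n j) /\ L n j `<=` N.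
  by split; [exact: lead_coefs_stable|move=> x []].
have LSl n j : L n j `<=` L n.+1 j.
  by apply: (lead_coefsS hN) => x; have [[_ _ cO] _] := hc j; apply: cO; left.
have Llel j n n' : (n <= n')%N -> L n j `<=` L n' j.
    exact: (chain_subset (c := fun n => L n j)).
have Ller n j j' : (j <= j')%N -> L n j `<=` L n j'.
  by move=> jj; apply: lead_coefs_mono; apply: cle.
(* [L n j] grows in both indices: the stationary diagonal settles all rows [n >= n0] at once, and
   finitely many rows remain. *)
have [n0 n0P] : exists n0, forall n, (n0 <= n)%N -> L n n = L n0 n0.
  apply: (aN (fun n => L n n)) => // n; apply: subset_trans (LSl _ _) _.
  exact: Ller.
have /choice[jn jnP] : forall n, exists j0, forall j, (j0 <= j)%N -> L n j = L n j0.
  by move=> n; apply: (aN (L n)) => // j; apply: Ller.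
pose J := maxn n0 (\max_(n < n0) jn n); exists J => j Jj.
apply/seteqP; split; last exact: cle.
apply: (lead_coefs_inj hN (u := u)) => //; first exact: cle.
  by case: (hc j).
move=> n; have [lt_n|le_n] := ltnP n n0.
  have jJ : (jn n <= J)%N.
    by apply: leq_trans (leq_maxr _ _); apply: (leq_bigmax (Ordinal lt_n)).
  by rewrite -/(L n j) -/(L n J) (jnP n J) // (jnP n j) // (leq_trans jJ).
apply: (@subset_trans _ (L n0 n0)).
  rewrite -(n0P (maxn n j)); last by rewrite leq_max le_n.
  apply: (subset_trans (Llel j _ _ (leq_maxl n j))).
  exact/Ller/leq_maxr.
apply: (subset_trans (Llel n0 _ _ le_n)); apply: Ller; exact: leq_maxl.
Qed.

End HilbertBasis.

Section PolynomialModules.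
Variable R : comNzRingType.
Implicit Types (s : seq R) (W : set {poly R}).

Definition poly_consts : set {poly R} := [set c%:P | c in [set: R]].

Definition size_le k : set {poly R} := [set p : {poly R} | (size p <= k)%N].

Lemma size_le_stable k : stable_under poly_consts (size_le k).
Proof.
split; rewrite /size_le /=.
- by rewrite size_poly0.
- move=> p q pk qk; rewrite (leq_trans (size_polyD _ _)) // size_polyN geq_max.
  by rewrite pk.
- by move=> _ p [c _ <-] pk; rewrite mul_polyC (leq_trans (size_scale_leq _ _)).
Qed.

(** A chain is controlled by its members of smaller degree together with its ideals of top
    coefficients. *)
Lemma acc_under_size_le k : acc (@is_ideal R) -> acc_under poly_consts (size_le k).
Proof.
move=> hR; elim: k => [|k IHk] c hc cS.
  exists 0%N => j _; suff c0 i : c i = [set 0] by rewrite !c0.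
  have [[ci0 _ _] cs] := hc i; apply/seteqP; split; last by move=> _ ->.
  by move=> p /cs; rewrite /size_le /= leqn0 size_poly_eq0 => /eqP.
have cle := chain_subset cS.
have [j1 j1P] : exists j0, forall j, (j0 <= j)%N ->
    c j `&` size_le k = c j0 `&` size_le k.
  apply: (IHk (fun j => c j `&` size_le k)) => [j|j p [cp pk]]; last first.
    by split=> //; apply: cS.
  split; last by move=> p [].
  have [[c0 cB cO] _] := hc j; have [s0 sB sO] := size_le_stable k.
  split=> //; first by move=> p q [cp kp] [cq kq]; split; [exact: cB|exact: sB].
  by move=> o p Oo [cp kp]; split; [exact: cO|exact: sO].
have [j2 j2P] : exists j0, forall j, (j0 <= j)%N ->
    (fun p : {poly R} => p`_k) @` c j = (fun p : {poly R} => p`_k) @` c j0.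
  apply: (hR (fun j => (fun p : {poly R} => p`_k) @` c j)) => j; last first.
    by move=> _ [p cp <-]; exists p => //; apply: cS.
  have [hcj _] := hc j; have [c0 _ cO] := hcj; split.
  - by exists 0 => //; rewrite coef0.
  - move=> _ _ [p cp <-] [q cq <-]; exists (p + q); last by rewrite coefD.
    exact: stableD hcj cp cq.
  - move=> a _ [p cp <-]; exists (a%:P * p); last by rewrite coefCM.
    by apply: cO => //; exists a.
exists (maxn j1 j2) => j; rewrite geq_max => /andP[j1j j2j].
apply/seteqP; split; last by apply: cle; rewrite geq_max j1j.
move=> p cp; have [q cq qk] : ((fun p : {poly R} => p`_k) @` c j2) p`_k.
  by rewrite -(j2P j) //; exists p.
have [hcj csz] := hc j; have [_ cB _] := hcj.
have cq' : c j q by apply: cle cq.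
have : (c j `&` size_le k) (p - q).
  split; first exact: cB.
  apply/leq_sizeP => i; rewrite leq_eqVlt => /predU1P[<-|lt_i].
    by rewrite coefB qk subrr.
  by rewrite coefB !nth_default ?subrr //; apply: leq_trans lt_i; apply: csz.
rewrite j1P // => -[cpq _]; rewrite -(subrK q p).
have [hcJ _] := hc (maxn j1 j2); apply: (stableD hcJ).
  by apply: cle cpq; rewrite leq_maxl.
by apply: cle cq; rewrite leq_maxr.
Qed.

(* The module [R[s_1 t, ..., s_r t] (R + R t + ... + R t^k)], and the operators over
   which it is noetherian. *)
Fixpoint rees_span k s : set {poly R} :=
  if s is a :: s' then power_span (rees_span k s') (a *: 'X) else size_le k.+1.

Fixpoint rees_ops s : set {poly R} :=
  if s is a :: s' then (a *: 'X) |` rees_ops s' else poly_consts.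

Lemma rees_span_stable k s : stable_under (rees_ops s) (rees_span k s).
Proof.
by elim: s => [|a s IHs]; [exact: size_le_stable|exact: power_span_stable].
Qed.

Lemma rees_span_acc k s : acc (@is_ideal R) -> acc_under (rees_ops s) (rees_span k s).
Proof.
move=> hR; elim: s => [|a s IHs]; first exact: acc_under_size_le.
by apply: acc_under_power_span => //; apply: rees_span_stable.
Qed.

Lemma rees_spanS k s : size_le k.+1 `<=` rees_span k s.
Proof.
elim: s => [//|a s IHs]; apply: subset_trans IHs _.
exact: power_spanS (rees_span_stable k s).
Qed.

Lemma rees_ops_const s c : rees_ops s c%:P.
Proof. by elim: s => [|a s IHs]; [exists c|right]. Qed.

Lemma rees_ops_gen s a : a \in s -> rees_ops s (a *: 'X).
Proof.
by elim: s => [//|b s IHs]; rewrite inE => /predU1P[->|/IHs]; [left|right].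
Qed.

Lemma rees_opsP s o : rees_ops s o ->
  (exists c, o = c%:P) \/ (exists2 a, a \in s & o = a *: 'X).
Proof.
elim: s => [|b s IHs] /=; first by move=> [c _ <-]; left; exists c.
move=> [->|/IHs[|[a as_ ->]]]; [right; exists b => //|by left|right; exists a => //].
  exact: mem_head.
by rewrite inE as_ orbT.
Qed.

End PolynomialModules.

Section ReesNoetherian.
Variables (R : comNzRingType) (I : set R) (F : admissible_filtration I).
Hypothesis hR : noetherian R.
Hypothesis hI : is_ideal I.

Lemma mul_ideal_min (J K L : set R) : is_ideal L ->
  (forall x y, J x -> K y -> L (x * y)) -> mul_ideal J K `<=` L.
Proof.
by move=> hL JKL; apply: gen_ideal_min => // _ [x [y [Jx Ky ->]]]; apply: JKL.
Qed.

Lemma mul_idealM (J K : set R) x y : J x -> K y -> mul_ideal J K (x * y).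
Proof. by move=> Jx Ky; apply: sub_gen_ideal; exists x, y. Qed.

Lemma mul_idealP (J K : set R) : is_ideal (mul_ideal J K).
Proof. exact: gen_idealP. Qed.

Lemma filP n : is_ideal (F n). Proof. exact: idealP. Qed.

Lemma filS n : F n.+1 `<=` F n.
Proof. by rewrite -addn1 PoszD; apply: fil_decr. Qed.

Lemma fil_le (i j : nat) : (i <= j)%N -> F j `<=` F i.
Proof.
move=> /subnK <-; elim: (j - i)%N => [//|k IHk]; rewrite addSn.
exact: subset_trans (@filS _) IHk.
Qed.

Lemma fil_mulSr n x y : F 1 x -> F n%:Z y -> F n.+1 (x * y).
Proof. by move=> Fx Fy; rewrite -add1n PoszD; apply: fil_mulr. Qed.

(** The bound [I_n <= I^(n-k)] places the Rees algebra inside a finite module over [R[It]]: in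
    degree [n > k], a coefficient is a sum of products of [n - k] generators of [I], leaving a
    factor of degree [k]. *)
Lemma rees_span_fil : exists k (s : seq R), I = gen_ideal [set` s] /\
  forall p : {poly R}, (forall i : nat, F i p`_i) -> rees_span k s p.
Proof.
have [k Fk] := fil_adm F; have [s Is] := hR hI; exists k, s; split=> // p Fp.
have [T0 TB TO] := rees_span_stable k s.
have TD x y : rees_span k s x -> rees_span k s y -> rees_span k s (x + y).
  by move=> ? ?; apply: stableD (rees_span_stable k s) _ _.
suff H (n : nat) c : expz_ideal I (n%:Z - k%:Z) c -> rees_span k s (c *: 'X^n).
  rewrite -[p]coefK poly_def; apply: (big_ind (rees_span k s)) => // i _.
  by apply: H; apply: (Fk i).2; apply: Fp.
have mono_ideal (i : nat) (y : R) : is_ideal [set z | rees_span k s ((z * y) *: 'X^i)].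
  split=> /=.
  - by rewrite mul0r scale0r.
  - by move=> x z; rewrite mulrDl scalerDl; apply: TD.
  - move=> a x Tx; rewrite -mulrA -scalerA -mul_polyC; apply: TO => //.
    exact: rees_ops_const.
elim: n c => [|n IHn] c.
  move=> _; apply: rees_spanS; rewrite /size_le /=.
  by rewrite (leq_trans (size_scale_leq _ _)) // size_polyXn.
have [le_nk|lt_kn] := leqP n.+1 k.
  move=> _; apply: rees_spanS; rewrite /size_le /=.
  by rewrite (leq_trans (size_scale_leq _ _)) // size_polyXn.
have -> : n.+1%:Z - k%:Z = (n - k).+1%:Z by lia.
have enk : (n - k)%:Z = n%:Z - k%:Z by lia.
suff sub : exp_ideal I (n - k).+1 `<=` [set z | rees_span k s ((z * 1) *: 'X^(n.+1))].
  by move=> /sub /=; rewrite mulr1.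
apply: mul_ideal_min => // x y Ix Iy /=; rewrite mulr1.
suff sub : I `<=` [set z | rees_span k s ((z * y) *: 'X^(n.+1))] by apply: sub.
rewrite {1}Is; apply: gen_ideal_min => // a sa /=.
have -> : (a * y) *: 'X^(n.+1) = (a *: 'X) * (y *: 'X^n) :> {poly R}.
  by rewrite -scalerAl -scalerAr scalerA exprS.
by apply: TO; [exact: rees_ops_gen|apply: IHn; rewrite -enk].
Qed.

Lemma rees_acc : acc (@is_ideal (rees F)).
Proof.
have hRa := noetherian_acc hR.
have [k [s [Is sF]]] := rees_span_fil => c hc cS.
have [||j0 j0P] := @rees_span_acc R k s hRa (fun j => @rees_val _ _ F @` c j).
- move=> j; split; last by move=> _ [p _ <-]; apply/sF/reesP.
  split; first by exists 0 => //; apply: ideal0.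
    by move=> _ _ [p cp <-] [q cq <-]; exists (p - q) => //; apply: (ideal_sub (hc j)).
  move=> o _ /rees_opsP oP [p cp <-].
  have Fo : o \in rees_pred F.
    case: oP => [[b ->]|[a sa ->]]; apply/rees_predP => i.
      by rewrite coefC; case: i => [|i] /=; [exact: fil0_full|exact: ideal0 (filP _)].
    rewrite coefZ coefX; case: i => [|[|i]] /=; rewrite ?mulr0; try exact: ideal0 (filP _).
    by rewrite mulr1; apply: fil1_of_ideal; rewrite Is; apply: sub_gen_ideal.
  by exists (Rees Fo * p) => //; apply: (ideal_mull _ (hc j)).
- by move=> j _ [p cp <-]; exists p => //; apply: cS.
exists j0 => j jj0; apply/seteqP; split; last exact: (chain_subset cS).
move=> p cp; have [q cq] : (@rees_val _ _ F @` c j0) (rees_val p) by rewrite -(j0P j) //; exists p.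
by move=> /rees_val_inj <-.
Qed.

Lemma fil_eventually_mul : exists N, forall n, (N <= n)%N ->
  F n.+1 `<=` mul_ideal I (F n).
Proof.
have hRa := noetherian_acc hR.
have [k [s [Is sF]]] := rees_span_fil.
have aF a : a \in s -> F 1 a by move=> sa; apply: fil1_of_ideal; rewrite Is; apply: sub_gen_ideal.
(* [E j] is the [R[It]]-submodule generated by the components of degree at most [j], so it equals
   [I^(n-j) I_j] in degrees [n > j]. Once the chain is stationary at [j0], degree [n + 1] of the
   Rees algebra is [I] times degree [n] of [E j0], for [n >= j0]. *)
pose E j n := iter (n - j) (mul_ideal I) (F (minn n j)).
have EP j n : is_ideal (E j n).
  by rewrite /E; case: (n - j)%N => [|i] /=; [exact: filP|exact: mul_idealP].
have Ele j (n : nat) : (n <= j)%N -> E j n = F n.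
  by move=> nj; rewrite /E (minn_idPl nj); move: nj; rewrite -subn_eq0 => /eqP->.
have Egt j n : (j <= n)%N -> E j n.+1 = mul_ideal I (E j n).
  by move=> jn; rewrite /E subSn // (minn_idPr jn) (minn_idPr (leqW jn)).
have IF (n : nat) : mul_ideal I (F n) `<=` F n.+1.
  apply: mul_ideal_min; first exact: filP.
  by move=> x y /(fil1_of_ideal F); apply: fil_mulSr.
have EF j (n : nat) : E j n `<=` F n.
  elim: n => [|n IHn]; first by rewrite Ele.
  have [nj|jn] := leqP n.+1 j; first by rewrite Ele.
  rewrite Egt //; apply: subset_trans _ (IF n).
  by apply: gen_idealS => _ [x [y [Ix Ey ->]]]; exists x, y; split=> //; apply: IHn.
have [||j0 j0P] := @rees_span_acc R k s hRa (fun j => [set p : {poly R} | forall n : nat, E j n p`_n]).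
- move=> j; split; last by move=> p Ep; apply: sF => i; apply: EF.
  split.
  + by move=> n; rewrite coef0; apply: ideal0.
  + by move=> p q Ep Eq n; rewrite coefB; apply: (ideal_sub (EP j n)).
  + move=> o p /rees_opsP[[b ->]|[a sa ->]] Ep n.
      by rewrite coefCM; apply: (ideal_mull _ (EP j n)).
    rewrite -scalerAl coefZ coefXM; case: n => [|n] /=; first by rewrite mulr0; apply: ideal0.
    have [nj|jn] := leqP n.+1 j.
      by rewrite Ele //; apply: fil_mulSr; [exact: aF|exact: EF].
    rewrite Egt //; apply: mul_idealM => //.
    by rewrite Is; apply: sub_gen_ideal.
- move=> j p Ep n; have [nj|jn] := leqP n j.+1; first by rewrite Ele //; apply: EF.
  have {Ep} := Ep n; case: n jn => // n; rewrite ltnS => jn.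
  elim: n p`_n.+1 jn => // n IHn c; rewrite ltnS => jn.
  rewrite (Egt j n.+1) ?leqW // (Egt j.+1 n.+1) //.
  move=> mc; apply: gen_idealS mc => _ [x [y [Ix Ey ->]]]; exists x, y; split=> //.
  move: jn; rewrite leq_eqVlt => /predU1P[ej|jn]; last exact: IHn.
  by rewrite ej Ele //; apply: EF Ey.
exists j0 => n j0n c Fc.
have : [set p : {poly R} | forall i : nat, E n.+1 i p`_i] (c *: 'X^(n.+1)).
  move=> i /=; rewrite coefZ coefXn; have [->|_] := eqVneq i n.+1.
    by rewrite mulr1 Ele.
  by rewrite mulr0; apply: ideal0.
rewrite j0P ?leqW // => /(_ n.+1); rewrite coefZ coefXn eqxx mulr1 Egt //.
by apply: gen_idealS => _ [x [y [Ix Ey ->]]]; exists x, y; split=> //; apply: EF Ey.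
Qed.

End ReesNoetherian.

(** ** Lengths as maximal chains of ideals *)

Section Chains.
Variable T : Type.
Implicit Types (P Q : set (set T)).

Definition chain_to P n (D : set T) : Prop := exists c : nat -> set T,
  [/\ (forall i, (i <= n)%N -> P (c i)), (forall i, (i < n)%N -> c i `<` c i.+1) & c n = D].

Lemma chain_to_length P n D : chain_to P n D -> chain_of_length P n.
Proof. by move=> [c [cP cS _]]; exists c. Qed.

Lemma chain_to0 P D : P D -> chain_to P 0 D.
Proof. by move=> PD; exists (fun=> D); split. Qed.

Lemma chain_to_ext P n D D' : chain_to P n D -> P D' -> D `<` D' -> chain_to P n.+1 D'.
Proof.
move=> [c [cP cS cD]] PD' DD'; exists (fun i => if (i <= n)%N then c i else D').
split; last by rewrite ltnn.
- by move=> i _; case: ifP => // /cP.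
- move=> i; rewrite !ltnS leq_eqVlt => /predU1P[->|lt_in].
    by rewrite eqxx ltnn /= cD.
  by rewrite lt_in orbT; apply: cS.
Qed.

Lemma chain_map (U : Type) P (Q : set (set U)) (f : set T -> set U) n :
  (forall D, P D -> Q (f D)) ->
  (forall D D', P D -> P D' -> D `<=` D' -> f D `<=` f D') ->
  (forall D D', P D -> P D' -> D `<=` D' -> f D' `<=` f D -> D' `<=` D) ->
  chain_of_length P n -> chain_of_length Q n.
Proof.
move=> PQ fle finj [c [cP cS]]; exists (f \o c); split=> i lt_in.
  exact/PQ/cP.
have Pi := cP _ (ltnW lt_in); have PSi := cP _ lt_in; have [le nle] := cS _ lt_in.
by split; [exact: fle|move=> /(finj _ _ Pi PSi le)].
Qed.

Lemma chain_subset_of P Q n : P `<=` Q -> chain_of_length P n -> chain_of_length Q n.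
Proof. by move=> PQ; apply: (@chain_map _ _ _ id). Qed.

End Chains.

Lemma is_max_unique (S : set nat) i j : is_max S i -> is_max S j -> i = j.
Proof. by move=> [Si iS] [Sj jS]; apply/eqP; rewrite eqn_leq; apply/andP; split; [exact: jS|exact: iS]. Qed.

Lemma bounded_is_max (S : set nat) n N : S n -> ubound S N -> exists i, is_max S i.
Proof.
move=> Sn; elim: N => [|N IHN] SN.
  by exists n; split=> // k /SN; rewrite leEnat leqn0 => /eqP->.
have [SN1|nSN1] := pselect (S N.+1); first by exists N.+1.
apply: IHN => k Sk; have := SN _ Sk.
rewrite !leEnat leq_eqVlt => /predU1P[ek|//]; by rewrite ek in Sk.
Qed.

Section Length.
Variable R : comPzRingType.
Implicit Types (A B C D : set R).

Definition between B A : set (set R) := [set D | [/\ is_ideal D, B `<=` D & D `<=` A]].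

Definition finite_length B A : Prop :=
  exists n, is_max (chain_of_length (between B A)) n.

(* Length of [A/B], with the junk value [0] when it is infinite. *)
Definition length B A : nat := xget 0%N (is_max (chain_of_length (between B A))).

Lemma lengthP B A : finite_length B A -> is_max (chain_of_length (between B A)) (length B A).
Proof. by move=> fl; rewrite /length; case: xgetP => [n -> //|none]; case: fl => n /none. Qed.

Lemma length_unique B A n : is_max (chain_of_length (between B A)) n -> length B A = n.
Proof. by move=> nmax; apply: (is_max_unique _ nmax); apply: lengthP; exists n. Qed.

Lemma between_self B A : is_ideal B -> B `<=` A -> between B A B.
Proof. by split. Qed.

Lemma chain_bound B A n : finite_length B A -> chain_of_length (between B A) n ->
  (n <= length B A)%N.
Proof. by move=> /lengthP[_]; apply. Qed.

Lemma finite_length_sub B A B' A' : finite_length B A -> is_ideal B' ->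
  B `<=` B' -> B' `<=` A' -> A' `<=` A -> finite_length B' A'.
Proof.
move=> fl hB' BB' B'A' A'A; apply: (@bounded_is_max _ 0%N (length B A)).
  by apply: chain_to_length (chain_to0 _); apply: between_self.
move=> n cn; apply: (chain_bound fl); apply: chain_subset_of cn => D [hD BD DA].
by split=> //; [exact: subset_trans BD|exact: subset_trans DA _].
Qed.

Lemma chain_concat A B C i j : B `<=` C -> C `<=` A ->
  chain_of_length (between B C) i -> chain_of_length (between C A) j ->
  chain_of_length (between B A) (i + j)%N.
Proof.
move=> BC CA [c [cP cS]] [d [dP dS]].
exists (fun k => if (k <= i)%N then c k else d (k - i)%N); split=> k lt_k.
  case: leqP => ki.
    by have [hc Bc cC] := cP _ ki; split=> //; apply: subset_trans CA.
  have [|hd Cd dA] := dP (k - i)%N; first by rewrite leq_subLR.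
  by split=> //; apply: subset_trans Cd.
have [ki|ki] := ltnP k i.
  by rewrite ltnW //; apply: cS.
have jpos : (0 < j)%N by lia.
have [ek|nk] := eqVneq k i.
  rewrite ek leqnn subSn // subnn.
  have [_ _ cC] := cP _ (leqnn i); have [_ Cd _] := dP _ (leq0n j).
  have [le nle] := dS _ jpos; split; first exact: subset_trans (subset_trans Cd le).
  by move=> d1c; apply: nle; apply: subset_trans d1c (subset_trans cC Cd).
have -> : (k <= i)%N = false by lia.
have -> : (k.+1 - i)%N = (k - i).+1 by lia.
by apply: dS; lia.
Qed.

(** By the modular law a strict inclusion stays strict after intersecting with [C] or after adding
    [C], so each step of the chain is counted on at least one side. *)
Lemma chain_split A B C n : is_ideal C -> B `<=` C -> C `<=` A -> is_ideal A ->
  chain_of_length (between B A) n -> exists i j, [/\ (n <= i + j)%N,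
    chain_of_length (between B C) i & chain_of_length (between C A) j].
Proof.
move=> hC BC CA hA [c [cP cS]].
have capP k : (k <= n)%N -> between B C (c k `&` C).
  move=> /cP[hc Bc cA]; split; [split|by move=> x Bx; split; [exact: Bc|exact: BC]|by move=> x []].
  - by split; apply: ideal0.
  - by move=> x y [cx Cx] [cy Cy]; split; apply: ideal_add.
  - by move=> a x [cx Cx]; split; apply: ideal_mull.
have addP k : (k <= n)%N -> between C A (add_ideal (c k) C).
  move=> /cP[hc Bc cA]; split; [exact: add_idealP|exact: add_idealSr|].
  by move=> _ [x [y [cx Cy ->]]]; apply: ideal_add => //; [exact: cA|exact: CA].
suff H k : (k <= n)%N -> exists i j, [/\ (k <= i + j)%N,
    chain_to (between B C) i (c k `&` C) & chain_to (between C A) j (add_ideal (c k) C)].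
  have [i [j [le ci cj]]] := H n (leqnn n).
  by exists i, j; split=> //; apply: chain_to_length; eassumption.
elim: k => [_|k IHk lt_k].
  by exists 0%N, 0%N; split=> //; apply: chain_to0; [exact: capP|exact: addP].
have [i [j [le ci cj]]] := IHk (ltnW lt_k).
have [ck nck] := cS k lt_k; have [hck _ _] := cP k (ltnW lt_k).
have [hck1 _ _] := cP _ lt_k.
have cap_le : c k `&` C `<=` c k.+1 `&` C by move=> x [/ck].
have add_le : add_ideal (c k) C `<=` add_ideal (c k.+1) C.
  by move=> _ [x [y [cx Cy ->]]]; exists x, y; split=> //; apply: ck.
have [cap_ge|cap_nge] := pselect (c k.+1 `&` C `<=` c k `&` C); last first.
  have ci' : chain_to (between B C) i.+1 (c k.+1 `&` C).
    by apply: (chain_to_ext ci); [exact: capP|split].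
  have [add_ge|add_nge] := pselect (add_ideal (c k.+1) C `<=` add_ideal (c k) C).
    have e : add_ideal (c k.+1) C = add_ideal (c k) C by apply/seteqP; split.
    by exists i.+1, j; rewrite e; split=> //; lia.
  exists i.+1, j.+1; split=> //; first by lia.
  by apply: (chain_to_ext cj); [exact: addP|split].
have [add_ge|add_nge] := pselect (add_ideal (c k.+1) C `<=` add_ideal (c k) C).
  exfalso; apply: nck => y cy.
  have [x [z [cx Cz ey]]] : add_ideal (c k) C y by apply/add_ge/add_idealSl.
  rewrite ey; apply: (ideal_add hck) => //.
  have [] : (c k `&` C) z; last by [].
  apply: cap_ge; split=> //; have -> : z = y - x by rewrite ey; ring.
  by apply: (ideal_sub hck1) => //; apply: ck.
have e : c k.+1 `&` C = c k `&` C by apply/seteqP; split.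
exists i, j.+1; rewrite e; split=> //; first by lia.
by apply: (chain_to_ext cj); [exact: addP|split].
Qed.

Lemma lengthD A B C : finite_length B A -> is_ideal A -> is_ideal B -> is_ideal C ->
  B `<=` C -> C `<=` A -> length B A = (length B C + length C A)%N.
Proof.
move=> fl hA hB hC BC CA.
have flBC := finite_length_sub fl hB (fun _ => id) BC CA.
have flCA := finite_length_sub fl hC BC CA (fun _ => id).
have [cBC _] := lengthP flBC; have [cCA _] := lengthP flCA.
apply/eqP; rewrite eqn_leq (chain_bound fl) ?andbT; last exact: (chain_concat BC CA).
have [cBA _] := lengthP fl; have [i [j [le ci cj]]] := chain_split hC BC CA hA cBA.
apply: (leq_trans le); apply: leq_add; exact: chain_bound.
Qed.

Lemma length_eq0 A B : finite_length B A -> is_ideal A -> is_ideal B -> B `<=` A ->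
  length B A = 0%N -> A `<=` B.
Proof.
move=> fl hA hB BA l0; apply: contrapT => AB.
have : chain_of_length (between B A) 1.
  apply: (@chain_to_length _ _ _ A); apply: (chain_to_ext (D := B)); [|by split..].
  by apply: chain_to0; apply: between_self.
by move=> /(chain_bound fl); rewrite l0.
Qed.

Lemma length_self A : is_ideal A -> length A A = 0%N.
Proof.
move=> hA; apply: length_unique; split.
  by apply: chain_to_length (chain_to0 _); apply: between_self.
move=> [//|n] [c [cP cS]]; have [_ /=] := cS 0%N isT; case.
have [_ Ac _] := cP 0%N isT; have [_ _ cA] := cP 1%N isT.
exact: subset_trans cA Ac.
Qed.

Lemma length_congr B A B' A' : (forall n,
    chain_of_length (between B A) n <-> chain_of_length (between B' A') n) ->
  length B A = length B' A'.
Proof.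
move=> e; rewrite /length; congr (xget _ (is_max _)).
by apply/seteqP; split=> n /e.
Qed.

(* Multiplication by [x] identifies [B/(B :&: (A : x))] with [(A + xB)/A]. *)
Lemma length_add_scaled A B x : is_ideal A -> is_ideal B ->
  length A (add_scaled A x B) = length (B `&` colon A x) B.
Proof.
move=> hA hB; apply: length_congr => n; split.
- apply: (chain_map (f := fun D => B `&` colon D x)).
  + move=> D [hD AD DAB]; split; last by move=> y [].
      split; [by split; apply: ideal0 => //; apply: colonP|..].
        by move=> y z [By Dy] [Bz Dz]; split; apply: ideal_add => //; apply: colonP.
      by move=> a y [By Dy]; split; apply: ideal_mull => //; apply: colonP.
    by move=> y [By Ay]; split=> //; apply: AD.
  + by move=> D D' _ _ DD' y [By Dy]; split=> //; apply: DD'.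
  + move=> D D' [hD AD DAB] [hD' AD' D'AB] DD' le y D'y.
    have [a [b [Aa Bb ey]]] := D'AB _ D'y; rewrite ey.
    apply: (ideal_add hD); first exact: AD.
    suff [_ Dxb] : (B `&` colon D x) b by [].
    apply: le; split=> //; rewrite /colon /=; have -> : x * b = y - a by rewrite ey; ring.
    by apply: (ideal_sub hD') => //; apply: AD'.
- apply: (chain_map (f := fun D => add_scaled A x D)).
  + move=> D [hD BD DB]; split; [exact: add_scaledP|exact: add_scaledSl|].
    by move=> _ [a [b [Aa Db ->]]]; exists a, b; split=> //; apply: DB.
  + by move=> D D' _ _ DD' _ [a [b [Aa Db ->]]]; exists a, b; split=> //; apply: DD'.
  + move=> D D' [hD BD DB] [hD' BD' D'B] DD' le y D'y.
    have [a [b [Aa Db ey]]] : add_scaled A x D (x * y) by apply/le/add_scaledM.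
    rewrite -[y](subrK b); apply: (ideal_add hD) => //; apply: BD; split.
      by apply: (ideal_sub hB); [exact: D'B|exact: DB].
    by rewrite /colon /= mulrBr ey; have -> : a + x * b - x * b = a by ring.
Qed.

Lemma qpi0 (J : ideal R) : qpi J 0 = 0.
Proof. by rewrite -[X in qpi J X](subrr 0) qpiB subrr. Qed.

Lemma has_length_between (J : ideal R) l : has_length (qring J : lmodType R) l ->
  is_max (chain_of_length (between (ideal_set J) setT)) l.
Proof.
have hJ := idealP J.
have iff n : chain_of_length (@is_submodule R (qring J)) n <->
    chain_of_length (between (ideal_set J) setT) n.
  split.
  - apply: (chain_map (f := fun N => [set x | N (qpi J x)])).
    + move=> N [N0 ND NZ]; split=> //; last first.
        by move=> x Jx /=; rewrite (_ : qpi J x = 0) // -(qpi0 J); apply/qpi_eq; rewrite subr0.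
      split; rewrite /= ?qpi0 //; first by move=> x y Nx Ny; rewrite qpiD; apply: ND.
      by move=> a x Nx; rewrite qpiZ; apply: NZ.
    + by move=> N N' _ _ NN' x; apply: NN'.
    + by move=> N N' _ _ _ le y; rewrite -[y]qpi_repr; apply: le.
  - apply: (chain_map (f := fun D => qpi J @` D)).
    + move=> D [hD JD _]; split.
      * by exists 0; [exact: ideal0|exact: qpi0].
      * move=> _ _ [x Dx <-] [y Dy <-]; exists (x + y); last exact: qpiD.
        exact: (ideal_add hD).
      * move=> a _ [x Dx <-]; exists (a * x); last exact: qpiZ.
        exact: (ideal_mull _ hD).
    + by move=> D D' _ _ DD' _ [x Dx <-]; exists x => //; apply: DD'.
    + move=> D D' [hD JD _] _ _ le y D'y; have [x Dx] := le _ (imageP _ D'y).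
      move=> /esym/qpi_eq yx; rewrite -(subrK x y); apply: (ideal_add hD) => //.
      exact: JD.
by move=> [cl lmax]; split; [exact/iff|move=> n /iff; apply: lmax].
Qed.

End Length.

(** ** Initial ideals in the Rees algebra *)

Lemma prime_ideal_exp (A : comPzRingType) (P : set A) x k :
  prime_ideal P -> P (x ^+ k) -> P x.
Proof.
move=> [hP PT Pprime]; elim: k => [|k IHk].
  by rewrite expr0 => /(ideal_full hP).
by rewrite exprS => /Pprime[].
Qed.

Section InitialIdeals.
Variables (R : comNzRingType) (m : set R) (I : set R) (F : admissible_filtration I).
Hypotheses (hR : noetherian R) (hm : local_ring m).
Hypotheses (hI : is_ideal I) (hIm : radical I = m).
Implicit Types (K : set R).

(* The ideal of the Rees algebra whose image in the associated graded ring [G] is the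
   ideal of initial forms of [K]; quotients of [G] are handled through such ideals. *)
Definition init_ideal K : set (rees F) :=
  [set p | forall i : nat, add_ideal K (F i.+1) (rees_val p)`_i].

(* The preimage of the homogeneous maximal ideal of the associated graded ring. *)
Definition rees_max : set (rees F) := [set p : rees F | m (rees_val p)`_0].

Definition add_fil K (n : nat) : set R := add_ideal K (F n).

Lemma add_filP K n : is_ideal K -> is_ideal (add_fil K n).
Proof. by move=> hK; apply: add_idealP => //; apply: filP. Qed.

Lemma add_fil_le K (i j : nat) : (i <= j)%N -> add_fil K j `<=` add_fil K i.
Proof.
by move=> ij _ [a [b [Ka Fb ->]]]; exists a, b; split=> //; apply: fil_le Fb.
Qed.

Lemma sub_add_fil K n : K `<=` add_fil K n.
Proof. by apply: add_idealSl; apply: filP. Qed.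

Lemma fil_sub_add_fil K (n : nat) : is_ideal K -> F n `<=` add_fil K n.
Proof. exact: add_idealSr. Qed.

Lemma rees_maxP : is_ideal rees_max.
Proof.
have hm' := local_ideal hm; split.
- by rewrite /rees_max /= coef0; apply: ideal0.
- by move=> p q mp mq; rewrite /rees_max /= coefD; apply: (ideal_add hm').
- by move=> p q mq; rewrite /rees_max /= coef0M; apply: (ideal_mull _ hm').
Qed.

Lemma add_fil_coefM K (p q : rees F) i : is_ideal K ->
  (forall j, (j <= i)%N -> add_fil K j.+1 (rees_val q)`_j) ->
  add_fil K i.+1 (rees_val (p * q))`_i.
Proof.
move=> hK Kq; have hA := add_filP i.+1 hK.
rewrite coefM; apply: (big_ind (add_fil K i.+1)); first exact: ideal0.
  by move=> x y; apply: (ideal_add hA).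
move=> j _; have [a [b [Ka Fb ->]]] := Kq (i - j)%N (leq_subr _ _); rewrite mulrDr.
apply: (ideal_add hA); first by apply: sub_add_fil; apply: (ideal_mull _ hK).
apply: fil_sub_add_fil => //.
have ij : (j + (i - j).+1)%N = i.+1 by have := ltn_ord j; lia.
by have := fil_mulr (reesP p j) Fb; rewrite -PoszD ij.
Qed.

Lemma init_idealP K : is_ideal K -> is_ideal (init_ideal K).
Proof.
move=> hK; split.
- by move=> i; rewrite coef0; apply: ideal0 (add_filP _ hK).
- by move=> p q Kp Kq i; rewrite coefD; exact: (ideal_add (add_filP i.+1 hK) (Kp i) (Kq i)).
- by move=> p q Kq i; apply: add_fil_coefM => // j _; apply: Kq.
Qed.

Lemma init_ideal0 : init_ideal [set 0] = @rees_shift _ _ F.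
Proof.
apply/seteqP; split=> p Fp i; have := Fp i; rewrite -[Posz i + 1]/(Posz (i + 1)) addn1.
  by move=> [_ [b [-> Fb ->]]]; rewrite add0r.
by move=> Fpi; exists 0, (rees_val p)`_i; rewrite add0r.
Qed.

Lemma rees_shift_init K : is_ideal K -> @rees_shift _ _ F `<=` init_ideal K.
Proof.
move=> hK; rewrite -init_ideal0 => p Kp i; have [_ [b [-> Fb ->]]] := Kp i.
by exists 0, b; split=> //; apply: ideal0.
Qed.

Lemma init_monoP K n y (Fy : F n%:Z y) : is_ideal K ->
  init_ideal K (rees_mono Fy) <-> add_fil K n.+1 y.
Proof.
move=> hK; split=> [/(_ n)|Ky i] /=; rewrite coefZ coefXn ?eqxx ?mulr1 //.
have [->|_] := eqVneq i n; first by rewrite mulr1.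
by rewrite mulr0; apply: ideal0 (add_filP _ hK).
Qed.

Lemma rees_monoM i j x y (Fx : F i%:Z x) (Fy : F j%:Z y) (Fxy : F (i + j)%N%:Z (x * y)) :
  rees_mono Fx * rees_mono Fy = rees_mono Fxy.
Proof.
apply: rees_val_inj; rewrite /= -scalerAl -scalerAr scalerA exprD; congr (_ *: _).
Qed.

Lemma rees_monoX i k x (Fx : F i%:Z x) :
  exists Fxk : F (k * i)%N%:Z (x ^+ k), rees_mono Fx ^+ k = rees_mono Fxk.
Proof.
elim: k => [|k [Fxk IHk]].
  exists (fil0_full F 1); apply: rees_val_inj => /=.
  by rewrite expr0 scale1r.
have Fx' : F (k.+1 * i)%N%:Z (x ^+ k.+1).
  by rewrite exprS mulSn PoszD; apply: fil_mulr.
exists Fx'; rewrite exprS IHk.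
have Fx'' : F (i + k * i)%N%:Z (x * x ^+ k) by rewrite PoszD; apply: fil_mulr.
by rewrite (rees_monoM _ _ Fx''); apply: rees_val_inj; rewrite /= -mulSn -exprS.
Qed.

Lemma rees_monoM1 x (p : rees F) (Fx : F 1%N x) i :
  (rees_val (rees_mono Fx * p))`_i = if i is j.+1 then x * (rees_val p)`_j else 0.
Proof. by rewrite /= -scalerAl coefZ coefXM; case: i => [|i] /=; rewrite ?mulr0. Qed.

(** Turns a condition on forms of degree [n] into an ideal of [R], where the avoidance argument
    takes place. *)
Definition mono_part (Q : set (rees F)) (n : nat) : set R :=
  [set y | exists Fy : F n y, Q (rees_mono Fy)].

Lemma mono_partP Q n : is_ideal Q -> is_ideal (mono_part Q n).
Proof.
move=> hQ; split.
- exists (ideal0 (filP F n)); suff -> : rees_mono (ideal0 (filP F n)) = 0 by apply: ideal0.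
  by apply: rees_val_inj; rewrite /= scale0r.
- move=> x y [Fx Qx] [Fy Qy]; exists (ideal_add (filP F n) Fx Fy).
  suff -> : rees_mono (ideal_add (filP F n) Fx Fy) = rees_mono Fx + rees_mono Fy.
    exact: (ideal_add hQ).
  by apply: rees_val_inj; rewrite /= scalerDl.
- move=> a x [Fx Qx]; exists (ideal_mull a (filP F n) Fx).
  suff -> : rees_mono (ideal_mull a (filP F n) Fx) = rees_const F a * rees_mono Fx.
    exact: (ideal_mull _ hQ).
  by apply: rees_val_inj; rewrite /= expr0 alg_polyC mul_polyC scalerA.
Qed.

(** Since [I_(n+1)] lies in [I I_n] for [n >= N], all monomials of degree above [N] are in [Q], and
    the power [N + 1] of any monomial of positive degree is among them. A constant in [m] has a
    power in [I], hence in [I_1], and as a constant that power lies in [rees_shift]. *)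
Lemma prime_contains_rees_max (Q : set (rees F)) : prime_ideal Q ->
  @rees_shift _ _ F `<=` Q -> F 1%N `<=` mono_part Q 1 -> rees_max `<=` Q.
Proof.
move=> Qprime shiftQ Q1; have [hQ _ _] := Qprime.
have [N FN] := fil_eventually_mul F hR hI.
have big n : (N <= n)%N -> F n.+1 `<=` mono_part Q n.+1.
  move=> Nn; apply: subset_trans (FN n Nn) _.
  apply: mul_ideal_min; first exact: mono_partP.
  move=> x y /(fil1_of_ideal F)/Q1[Fx Qx] Fy; exists (fil_mulSr Fx Fy).
  have := rees_monoM Fx Fy (fil_mulSr Fx Fy) => <-.
  exact: (ideal_mulr _ hQ).
have pos n y (Fy : F n.+1 y) : Q (rees_mono Fy).
  apply: (prime_ideal_exp (k := N.+1) Qprime); have [Fyk ->] := rees_monoX N.+1 Fy.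
  move: Fyk; rewrite mulSn addSn => Fyk.
  have [|Fy' Qy] := big (n + N * n.+1)%N _ _ Fyk; first by rewrite mulnS; lia.
  by have -> : rees_mono Fyk = rees_mono Fy' by apply: rees_val_inj.
have const y (Fy : F 0%N y) : m y -> Q (rees_mono Fy).
  rewrite -hIm => -[k Iyk]; apply: (prime_ideal_exp (k := k) Qprime).
  have [Fyk ->] := rees_monoX k Fy; apply: shiftQ => i /=.
  rewrite muln0 coefZ coefXn -[Posz i + 1]/(Posz (i + 1)) addn1.
  case: i => [|i]; last by rewrite mulr0; apply: ideal0 (filP _ _).
  by rewrite mulr1; apply: fil1_of_ideal.
move=> p mp; rewrite [p]rees_sum; apply: ideal_sum => // i.
case: i => -[|i] lt_i /=; [exact: const|exact: pos].
Qed.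

Lemma fil1_prime_contains (P : set R) : prime_ideal P -> F 1%N `<=` P -> m `<=` P.
Proof.
move=> Pprime FP x; rewrite -hIm => -[k Ixk].
by apply: (prime_ideal_exp (k := k) Pprime); apply/FP/fil1_of_ideal.
Qed.

Variable u : nat -> R.
Hypothesis hu : unit_differences u.

(** A single avoidance in the ideal [I_1] treats annihilators in [R] and in the Rees algebra
    together. [E] limits where injectivity is required: everywhere if the graded quotient has
    positive depth, in high degrees otherwise. *)
Lemma exists_generic K (E : set (rees F)) : is_ideal K -> is_ideal E ->
    socle_free m K ->
    (forall a, E a -> (forall f, rees_max f -> init_ideal K (f * a)) -> init_ideal K a) ->
  exists x (Fx : F 1%N x), nzd_mod K x /\
    forall p, E p -> init_ideal K (rees_mono Fx * p) -> init_ideal K p.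
Proof.
move=> hK hE sK sE; have hRa := noetherian_acc hR.
have hin := init_idealP hK.
have [s [sP sann]] := @maximal_annihilators R K setT hRa hK (fun _ _ _ => Logic.I).
have [t [tP tann]] := @maximal_annihilators _ (init_ideal K) E (rees_acc hR hI (F := F)) hin
  (fun x y Ex => ideal_mulr y hE Ex).
have [|X tX sX] := @thin_seq R R (F 1%N) s (colon K).
  move=> a /sP[_ Ka aprime]; split; first exact: colonP.
  move=> /(fil1_prime_contains aprime) ma; apply: Ka; apply: sK => f /ma.
  by rewrite /colon /= mulrC.
have [|Y tY tY'] := @thin_seq R (rees F) (F 1%N) t
    (fun a => mono_part (colon (init_ideal K) a) 1).
  move=> a /tP[Ea Ka aprime]; split; first exact/mono_partP/colonP.
  move=> /(prime_contains_rees_max aprime) ma; apply: Ka; apply: sE => // f mf.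
  rewrite mulrC; apply: ma mf => p /(rees_shift_init hK).
  by apply: ideal_mull.
have [x Fx nx] := avoid_thin hu (filP F 1) (thin_setU tX tY).
exists x, Fx; split.
  move=> y Kxy; apply: contrapT => Ky.
  have [b bs yb] := sann y Logic.I Ky; apply: nx; left; apply: (sX b bs); apply: yb.
  by rewrite /colon /= mulrC.
move=> p Ep Kxp; apply: contrapT => Kp.
have [b bt pb] := tann p Ep Kp; apply: nx; right; apply: (tY' b bt); exists Fx; apply: pb.
by rewrite /colon /= mulrC.
Qed.

Section RegularStep.
Variables (K : set R) (x : R) (Fx : F 1%N x).
Hypotheses (hK : is_ideal K) (xreg : nzd_mod (init_ideal K) (rees_mono Fx)).

Lemma nzd_init_mono n y : F n%:Z y -> add_fil K n.+2 (x * y) -> add_fil K n.+1 y.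
Proof.
move=> Fy Kxy; apply/(init_monoP Fy hK); apply: xreg.
have Fxy : F (1 + n)%N (x * y) by apply: fil_mulSr.
by rewrite (rees_monoM Fx Fy Fxy); apply/init_monoP.
Qed.

(** [y] is moved from [K + I_l] to [K + I_(l+1)] one degree at a time, starting from [I_0 = R];
    [l < n] gives [I_(n+1) <= I_(l+2)], as [nzd_init_mono] requires. *)
Lemma colon_add_fil n : colon (add_fil K n.+1) x = add_fil K n.
Proof.
apply/seteqP; split=> y; last first.
  move=> [a [b [Ka Fb ->]]]; rewrite /colon /= mulrDr.
  exists (x * a), (x * b); split=> //; first exact: ideal_mull.
  exact: fil_mulSr.
rewrite /colon /= => Kxy; suff H l : (l <= n)%N -> add_fil K l y by apply: H.
elim: l => [_|l IHl ln]; first by exists 0, y; split; [exact: ideal0|exact: fil0_full|rewrite add0r].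
have [a [b [Ka Fb ey]]] := IHl (ltnW ln); rewrite ey.
apply: (ideal_add (add_filP _ hK)); first exact: sub_add_fil.
apply: nzd_init_mono => //; have -> : x * b = x * y - x * a by rewrite ey; ring.
apply: (ideal_sub (add_filP _ hK)); first exact: add_fil_le Kxy.
by apply: sub_add_fil; apply: (ideal_mull _ hK).
Qed.

(** Since [(K + I_(i+1)) : x = K + I_i], the cofactor of [x] in a coefficient of degree [i + 1] can
    be corrected by an element of [K] into [I_i]; the corrected cofactors form an element of the
    Rees algebra. *)
Lemma init_adjoin : init_ideal (adjoin K x) = adjoin (init_ideal K) (rees_mono Fx).
Proof.
have hKx := adjoinP x hK; apply/seteqP; split=> p.
- move=> Kxp.
  have /choice[c cP] : forall i : nat, exists c, F i.-1 c /\
      add_fil K i.+1 ((rees_val p)`_i - if i is j.+1 then x * c else 0).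
    case=> [|i].
      (* In degree zero the multiple of [x] already lies in [I_1] and is absorbed. *)
      exists 0; split; first exact: ideal0 (filP _ _).
      rewrite subr0; have [_ [b [[a [c [Ka _ ->]]] Fb ->]]] := Kxp 0%N.
      rewrite -addrA; exists a, (x * c + b); split=> //.
      by apply: (ideal_add (filP _ _)) => //; apply: (ideal_mulr _ (filP F 1)).
    have [_ [b [[a [c [Ka _ ->]]] Fb ep]]] := Kxp i.+1.
    have [a' [c' [Ka' Fc' ec]]] : add_fil K i c.
      rewrite -colon_add_fil /colon /=.
      have -> : x * c = (rees_val p)`_i.+1 - b - a by rewrite ep; ring.
      apply: (ideal_sub (add_filP _ hK)); last exact: sub_add_fil.
      apply: (ideal_sub (add_filP _ hK)); apply: fil_sub_add_fil => //.
        exact: reesP.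
      exact: filS.
    exists c'; split=> //; exists (a + x * a'), b; split=> //.
      by apply: (ideal_add hK) => //; apply: (ideal_mull _ hK).
    by rewrite ep ec; ring.
  have Fq : \poly_(j < size (rees_val p)) c j.+1 \in rees_pred F.
    apply/rees_predP => i; rewrite coef_poly; case: ifP => _.
      by have [] := cP i.+1.
    exact: ideal0 (filP _ _).
  exists (p - rees_mono Fx * Rees Fq), (Rees Fq); split=> //; last by ring.
  move=> i; rewrite coefB rees_monoM1; have [_] := cP i; case: i => [//|i] /=.
  rewrite coef_poly; case: ltnP => // le_i _.
  rewrite nth_default ?(leqW le_i) // mulr0 subr0.
  exact: ideal0 (add_filP _ hK).
- move=> [q [h [Kq _ ->]]]; have hin := init_idealP hKx; apply: (ideal_add hin).
    move=> i; have [a [b [Ka Fb ->]]] := Kq i; exists a, b; split=> //.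
    exact: adjoinS.
  apply: (ideal_mulr _ hin); apply/(init_monoP Fx hKx); apply: sub_add_fil.
  by exists 0, 1; split=> //; [exact: ideal0|rewrite add0r mulr1].
Qed.

End RegularStep.
End InitialIdeals.

(** ** Hilbert coefficients *)

(** Pascal's rule; the term of index [d + 1] is constant in [n] and cancels. Hence [e_0, ..., e_d]
    are unchanged when the dimension drops from [d + 1] to [d]. *)
Lemma binomial_sum_diff (e : nat -> int) (d n : nat) :
  \sum_(i < d.+2) (-1) ^+ i * e i * ('C(n.+1 + d.+1 - 1 - i, d.+1 - i))%:Z
  - \sum_(i < d.+2) (-1) ^+ i * e i * ('C(n + d.+1 - 1 - i, d.+1 - i))%:Z
  = \sum_(i < d.+1) (-1) ^+ i * e i * ('C(n.+1 + d - 1 - i, d - i))%:Z.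
Proof.
rewrite !(big_ord_recr d.+1) /= !subnn !bin0 opprD addrACA subrr addr0 -sumrB.
apply: eq_bigr => i _; rewrite -mulrBr; congr (_ * _).
have id := ltn_ord i.
have -> : (n.+1 + d.+1 - 1 - i)%N = (n + d - i).+1 by lia.
have -> : (d.+1 - i)%N = (d - i).+1 by lia.
have -> : (n + d.+1 - 1 - i)%N = (n + d - i)%N by lia.
have -> : (n.+1 + d - 1 - i)%N = (n + d - i)%N by lia.
by rewrite binS PoszD; ring.
Qed.

Lemma binomial2S k : ('C(k.+2, 2))%:Z = ('C(k.+1, 2))%:Z + k.+1%:Z :> int.
Proof. by rewrite binS bin1 PoszD. Qed.

Lemma partial_sums_difference (L S : nat -> nat) (N : nat) (e0 e1 : int) :
    (forall n, S n.+1 = (S n + L n.+1)%N) ->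
    (forall n, (N <= n)%N -> (S n)%:Z = e0 * ('C(n.+1, 2))%:Z - e1 * n%:Z) ->
  forall n, (N <= n)%N -> (L n.+1)%:Z = e0 * n.+1%:Z - e1.
Proof.
move=> SS SN n Nn; have := SN n.+1 (leqW Nn); rewrite SS PoszD (SN n Nn) binomial2S.
have -> : n.+1%:Z = n%:Z + 1 by rewrite -addn1 PoszD.
by move=> e; have := congr1 (fun z => z - (e0 * ('C(n.+1, 2))%:Z - e1 * n%:Z)) e; lia.
Qed.

(** In the application [q] is the length of [R/(K + xR)] and [v] measures the failure of
    [I_(n+1) + K = x I_n + K]. The formula for [S] has no constant term: this is [e_2 = 0]. *)
Lemma vanishing_defects (L S v : nat -> nat) (q N : nat) (e0 e1 : int) :
    S 0%N = 0%N -> (forall n, S n.+1 = (S n + L n.+1)%N) ->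
    (forall n, (L n.+1 + v n = L n + q)%N) -> (forall n, (N <= n)%N -> v n = 0%N) ->
    (forall n, (N <= n)%N -> (S n)%:Z = e0 * ('C(n.+1, 2))%:Z - e1 * n%:Z) ->
  forall n, v n.+1 = 0%N.
Proof.
move=> S0 SS Lv vN SN.
have LN := partial_sums_difference SS SN.
have e0q : e0 = q%:Z.
  have := Lv N.+1; rewrite vN // addn0 => /(congr1 Posz); rewrite PoszD !LN //.
  by lia.
pose w n : int := (L n)%:Z - q%:Z * n%:Z + e1.
have wS n : w n = w n.+1 + (v n)%:Z.
  by rewrite /w; have := Lv n; lia.
have wN n : (N <= n)%N -> w n.+1 = 0 by move=> Nn; rewrite /w LN // e0q; lia.
have w_ge0 n : 0 <= w n.
  have H k i : (N < i + k)%N -> 0 <= w i.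
    elim: k i => [|k IHk] i lt_i.
      by case: i lt_i => // i lt_i; rewrite wN //; lia.
    by rewrite wS addr_ge0 // IHk //; lia.
  by apply: (H N.+1); lia.
(* [T n] is [w 1 + ... + w n]: nondecreasing, zero at [0] and zero for large [n], hence identically
   zero. The sum starts at [w 1], so the conclusion starts at [v 1]. *)
pose T n : int := (S n)%:Z - q%:Z * ('C(n.+1, 2))%:Z + e1 * n%:Z.
have TS n : T n.+1 = T n + w n.+1.
  by rewrite /T /w SS binomial2S; lia.
have TN n : (N <= n)%N -> T n = 0 by move=> Nn; rewrite /T SN // e0q; lia.
have Tle i j : (i <= j)%N -> T i <= T j.
  move=> /subnK <-; elim: (j - i)%N => [//|k IHk]; rewrite addSn TS.
  by apply: le_trans IHk _; rewrite lerDl.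
have T0 n : T n = 0.
  apply/eqP; rewrite eq_le; apply/andP; split.
    by rewrite -(TN (maxn n N)) ?leq_maxr // Tle ?leq_maxl.
  have -> : 0 = T 0%N by rewrite /T S0 bin_small //; lia.
  exact: Tle.
have w0 n : w n.+1 = 0 by have := TS n; rewrite !T0; lia.
by move=> n; have := wS n.+1; rewrite !w0; lia.
Qed.

(** * Descent to dimension one and the gain of one unit of depth *)

Section Depth.
Variables (R : comNzRingType) (m : set R) (I : set R) (F : admissible_filtration I).
Hypotheses (hR : noetherian R) (hm : local_ring m).
Hypotheses (hI : primary_ideal I) (hIm : radical I = m).
Hypothesis flF : forall n : nat, finite_length (F n) setT.
Variable u : nat -> R.
Hypothesis hu : unit_differences u.
Implicit Types (K : set R).

Local Notation MR := (@rees_max R m I F).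
Local Notation init := (@init_ideal R I F).
Local Notation add_fil := (add_fil F).

Let hIi : is_ideal I. Proof. by case: hI. Qed.

Lemma fil1_sub_max : F 1%N `<=` m.
Proof. exact: ideal_of_fil1 hIm hI. Qed.

Lemma rees_mono1_max x (Fx : F 1%N x) : MR (rees_mono Fx).
Proof.
rewrite /rees_max /= coefZ coefX mulr0; apply: ideal0; exact: local_ideal hm.
Qed.

Lemma finite_length_fil (n : nat) (B A : set R) : is_ideal B -> F n `<=` B -> B `<=` A ->
  finite_length B A.
Proof. by move=> hB FB BA; apply: (finite_length_sub (flF n)). Qed.

Definition colength K (n : nat) : nat := length (add_fil K n) setT.

Lemma length_add_filS K n : is_ideal K ->
  (colength K n.+1 = length (add_fil K n.+1) (add_fil K n) + colength K n)%N.
Proof.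
move=> hK; have hA i := add_filP F i hK.
apply: lengthD => //; last exact: add_fil_le.
by apply: (@finite_length_fil n.+1) => //; apply: fil_sub_add_fil.
Qed.

Lemma add_fil0 K : is_ideal K -> add_fil K 0 = setT.
Proof.
move=> hK; apply/seteqP; split=> // x _; apply: fil_sub_add_fil => //.
exact: fil0_full.
Qed.

(** By [colon_add_fil], [x] embeds [R/(K + I_n)] into [R/(K + I_(n+1))], with cokernel
    [R/(K + xR + I_(n+1))]. *)
Lemma colength_adjoin K x (Fx : F 1%N x) n : is_ideal K ->
  nzd_mod (init K) (rees_mono Fx) ->
  colength K n.+1 = (colength (adjoin K x) n.+1 + colength K n)%N.
Proof.
move=> hK xreg; have hA := add_filP F n.+1 hK.
rewrite /colength (@lengthD _ _ _ (add_scaled (add_fil K n.+1) x setT)) //.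
- rewrite addnC; congr (_ + _)%N.
    congr (length _ _); apply/seteqP; split=> _ [a [b [Ha Hb ->]]].
      move: Ha => [k [f [Kk Ff ->]]]; exists (k + x * b), f; split=> //; last by ring.
      by exists k, b.
    move: Ha => [k [c [Kk _ ->]]]; exists (k + b), c; split=> //; last by ring.
    by exists k, b.
  by rewrite length_add_scaled // setTI (colon_add_fil hK xreg).
- by apply: (@finite_length_fil n.+1) => //; apply: fil_sub_add_fil.
- exact: add_scaledP.
- exact: add_scaledSl.
Qed.

(** The socle of the graded quotient is noetherian, hence of bounded degree. Above that degree an
    injective form of degree one exists even in depth zero. *)
Lemma socle_bounded K : is_ideal K -> exists j0, forall p : rees F,
  (forall i, (i <= j0)%N -> add_fil K i.+1 (rees_val p)`_i) ->
  (forall f, MR f -> init K (f * p)) -> init K p.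
Proof.
move=> hK; have hin := init_idealP F hK; have hA n := add_filP F n hK.
(* The socle elements concentrated in degrees at most [j] form an ascending chain. *)
pose V j : set (rees F) := [set p | (forall f, MR f -> init K (f * p)) /\
  forall n, (j < n)%N -> add_fil K n.+1 (rees_val p)`_n].
have [||j0 j0P] := @rees_acc R I F hR hIi V.
- move=> j; split.
  + split=> [f _|n _]; first by rewrite mulr0; apply: ideal0.
    by rewrite coef0; apply: ideal0 (hA _).
  + move=> p q [sp Vp] [sq Vq]; split=> [f mf|n jn].
      by rewrite mulrDr; apply: (ideal_add hin); [exact: sp|exact: sq].
    by rewrite coefD; apply: (ideal_add (hA _)); [exact: Vp|exact: Vq].
  + move=> g p [sp Vp]; split=> [f mf|n jn].
      by rewrite mulrCA; apply: (ideal_mull _ hin); apply: sp.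
    (* The part of [g] without constant term kills the socle element [p]; the constant term
       preserves degrees. *)
    have mg : MR (g - rees_const F (rees_val g)`_0).
      rewrite /rees_max /= coefB coefZ coefXn eqxx mulr1 subrr.
      exact: ideal0 (local_ideal hm).
    rewrite -[g](subrK (rees_const F (rees_val g)`_0)) mulrDl coefD.
    apply: (ideal_add (hA _)); first exact: (sp _ mg n).
    rewrite /= expr0 alg_polyC coefCM; apply: (ideal_mull _ (hA _)).
    exact: Vp.
- move=> j p [sp Vp]; split=> // n jn; apply: Vp; exact: ltnW.
exists j0 => p lep sp i; have [|lt_i] := leqP i j0; first exact: lep.
have : V (maxn j0 (size (rees_val p))) p.
  split=> // n; rewrite gtn_max => /andP[_ lt_n].
  by rewrite nth_default ?(ltnW lt_n) //; apply: ideal0 (hA _).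
by rewrite j0P ?leq_maxl // => -[_]; apply.
Qed.

Section DimensionOne.
Variables (K : set R) (x : R) (Fx : F 1%N x).
Hypotheses (hK : is_ideal K) (xK : nzd_mod K x).

Local Notation A := (add_fil K).
Let hA n : is_ideal (A n). Proof. exact: add_filP. Qed.

Let P n := add_scaled K x (A n).
Let hP n : is_ideal (P n). Proof. exact: add_scaledP. Qed.

Let xA n y : A n y -> A n.+1 (x * y).
Proof.
move=> [a [b [Ka Fb ->]]]; rewrite mulrDr; exists (x * a), (x * b); split=> //.
  exact: (ideal_mull _ hK).
exact: fil_mulSr.
Qed.

Lemma add_scaled_fil_sub n : P n `<=` A n.+1.
Proof.
move=> _ [a [b [Ka Ab ->]]]; apply: (ideal_add (hA _)); first exact: sub_add_fil.
exact: xA.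
Qed.

Let PS i j : (i <= j)%N -> P j `<=` P i.
Proof.
by move=> ij _ [a [b [Ka Ab ->]]]; exists a, b; split=> //; apply: add_fil_le Ab.
Qed.

(** For large [n], [x] maps [(K + I_n)/(K + I_(n+1))] injectively to the next such quotient, of the
    same length [e0], hence onto it: [I_(n+1) + K = x I_n + I_(n+2) + K]. Nakayama removes
    [I_(n+2)], which lies in [I I_(n+1)]. *)
Lemma add_fil_generated (N : nat) (e0 : int) :
    (forall n y, (N <= n)%N -> F n y -> A n.+2 (x * y) -> A n.+1 y) ->
    (forall n, (N <= n)%N -> (colength K n.+1)%:Z = (colength K n)%:Z + e0) ->
  exists N', forall n, (N' <= n)%N -> A n.+1 `<=` P n.
Proof.
move=> xinj const; have [N0 N0P] := fil_eventually_mul F hR hIi.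
exists (maxn N N0) => n; rewrite geq_max => /andP[Nn N0n].
have hC : is_ideal (add_scaled (A n.+2) x (A n)) by apply: add_scaledP.
have CA : add_scaled (A n.+2) x (A n) `<=` A n.+1.
  move=> _ [a [b [Aa Ab ->]]]; apply: (ideal_add (hA _)); last exact: xA.
  exact: add_fil_le Aa.
have fl2 : finite_length (A n.+2) (A n.+1).
  apply: (@finite_length_fil n.+2) => //; first exact: fil_sub_add_fil.
  exact: add_fil_le.
have eqA : A n `&` colon (A n.+2) x = A n.+1.
  apply/seteqP; split=> y.
    move=> [[a [b [Ka Fb ->]]]]; rewrite /colon /= mulrDr => Axy.
    apply: (ideal_add (hA _)); first exact: sub_add_fil.
    apply: xinj => //; apply: (ideal_subl (hA _) (y := - (x * a))).
      rewrite -mulNr; apply: sub_add_fil; exact: (ideal_mull _ hK).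
    by rewrite opprK addrC.
  by move=> Ay; split; [exact: add_fil_le Ay|exact: xA].
have AC : A n.+1 `<=` add_scaled (A n.+2) x (A n).
  apply: length_eq0 => //.
    apply: (@finite_length_fil n.+2) => //.
    apply: (@subset_trans _ (A n.+2)); first exact: fil_sub_add_fil.
    exact: add_scaledSl.
  have := lengthD fl2 (hA _) (hA _) hC (add_scaledSl x (hA _)) CA.
  rewrite length_add_scaled // eqA.
  have := const n Nn; have := const n.+1 (leqW Nn).
  by rewrite !length_add_filS //; lia.
apply: (nakayama (noetherian_acc hR) hm (hP n) (hA n.+1) (@add_scaled_fil_sub n)) => C hC' PC EmC.
apply: subset_trans AC _ => _ [a [b [[c [f [Kc Ff ->]]] Ab ->]]].
have Kx : C (c + x * b) by apply: PC; exists c, b.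
suff Cf : C f by rewrite addrAC; apply: (ideal_add hC').
have : F n.+2 `<=` C; last by apply.
apply: subset_trans (N0P n.+1 (leqW N0n)) _; apply: mul_ideal_min => // y z Iy Fz.
apply: EmC; last exact: fil_sub_add_fil.
by rewrite -hIm; exists 1%N.
Qed.

(** The length of [R/P n] is computed through [K + I_(n+1)] and through [K + xR]; as [x] is regular
    modulo [K], [(K + xR)/P n] is a copy of [R/(K + I_n)]. Generation in large degrees makes these
    lengths finite. *)
Lemma colength_defect n N' : (forall i, (N' <= i)%N -> A i.+1 `<=` P i) ->
  finite_length (P n) (A n.+1) /\
  (colength K n.+1 + length (P n) (A n.+1) = colength K n + length (adjoin K x) setT)%N.
Proof.
move=> gen.
have FP : F (maxn n N').+1 `<=` P n.
  apply: (@subset_trans _ (A (maxn n N').+1)); first exact: fil_sub_add_fil.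
  by apply: subset_trans (gen _ (leq_maxr _ _)) _; apply/PS/leq_maxl.
have fl B : P n `<=` B -> finite_length (P n) B.
  by move=> PB; apply: finite_length_fil FP PB.
split; first by apply: fl; exact: add_scaled_fil_sub.
have := lengthD (fl setT (fun _ _ => Logic.I)) (is_idealT _) (hP n) (hA n.+1) (@add_scaled_fil_sub n) (fun _ _ => Logic.I).
rewrite addnC => <-.
have eqQ : add_scaled (P n) x setT = adjoin K x.
  apply/seteqP; split=> _ [a [b [Ha Hb ->]]].
    by move: Ha => [c [d [Kc Ad ->]]]; exists c, (d + b); split=> //; ring.
  exists a, b; split=> //; exact: add_scaledSl.
rewrite (@lengthD _ _ _ (add_scaled (P n) x setT)) //.
- rewrite length_add_scaled // setTI eqQ; congr (length _ _ + _)%N.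
  apply/seteqP; split=> y; last exact: add_scaledM.
  move=> [a [b [Ka Ab ey]]]; rewrite -[y](subrK b); apply: (ideal_add (hA _)) => //.
  apply: sub_add_fil; apply: xK; have -> : x * (y - b) = a by rewrite mulrBr ey; ring.
  by [].
- exact: fl.
- exact: add_scaledP.
- exact: add_scaledSl.
Qed.

(** A coefficient of degree [n] is tested after multiplication by [x] in
    [K + I_(n+2) = K + x I_(n+1)], where [x] cancels modulo [K]. So the relevant defects are exactly
    [v 1, v 2, ...]. *)
Lemma nzd_init_of_generated : (forall n, A n.+2 `<=` P n.+1) ->
  nzd_mod (init K) (rees_mono Fx).
Proof.
move=> gen p Kxp n; have := Kxp n.+1; rewrite rees_monoM1 => /gen[a [b [Ka Ab exp]]].
rewrite -[_`_n](subrK b); apply: (ideal_add (hA _)) => //; apply: sub_add_fil.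
by apply: xK; have -> : x * ((rees_val p)`_n - b) = a by rewrite mulrBr exp; ring.
Qed.

End DimensionOne.

Lemma depth_init_dim1 K (S : nat -> nat) (N : nat) (e0 e1 : int) : is_ideal K ->
    depth_ge m K 1 -> S 0%N = 0%N -> (forall n, S n.+1 = (S n + colength K n.+1)%N) ->
    (forall n, (N <= n)%N -> (S n)%:Z = e0 * ('C(n.+1, 2))%:Z - e1 * n%:Z) ->
  depth_ge MR (init K) 1.
Proof.
move=> hK Kdepth S0 SS SN.
have hA n := add_filP F n hK.
have [j0 j0P] := socle_bounded hK.
(* Elements vanishing up to the socle bound: on these, [x] can be made injective. *)
pose E : set (rees F) := [set p | forall i, (i <= j0)%N -> add_fil K i.+1 (rees_val p)`_i].
have hE : is_ideal E.
  split.
  - by move=> i _; rewrite coef0; apply: ideal0 (hA _).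
  - by move=> p q Ep Eq i ij; rewrite coefD; apply: (ideal_add (hA _)); [exact: Ep|exact: Eq].
  - move=> p q Eq i ij; apply: add_fil_coefM => // j ji; apply: Eq; exact: leq_trans ij.
have [x [Fx [xK xE]]] := exists_generic hR hIi hIm hu hK hE (depth_ge_socle_free Kdepth) j0P.
have xinj n y : (j0.+1 <= n)%N -> F n y -> add_fil K n.+2 (x * y) -> add_fil K n.+1 y.
  move=> jn Fy Axy; apply/(init_monoP Fy hK); apply: xE.
    move=> i ij /=; rewrite coefZ coefXn; have -> : (i == n) = false by lia.
    by rewrite mulr0; apply: ideal0 (hA _).
  have Fxy : F (1 + n)%N (x * y) by apply: fil_mulSr.
  by rewrite (rees_monoM Fx Fy Fxy); apply/init_monoP.
have LN := partial_sums_difference SS SN.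
(* [j0 + 1] is where injectivity starts; [N + 1] appears because [LN] gives the values of
   [colength K] at successors. *)
have [n y|n|N' gen] := @add_fil_generated K x Fx hK (maxn j0.+1 N.+1) e0.
- by rewrite geq_max => /andP[jn _]; apply: xinj.
- rewrite geq_max => /andP[_]; case: n => // n; rewrite ltnS => Nn.
  by rewrite !LN ?leqW //; lia.
have defect n := colength_defect Fx hK xK n gen.
pose v n := length (add_scaled K x (add_fil K n)) (add_fil K n.+1).
exists (rees_mono Fx); split=> //; first exact: rees_mono1_max.
apply: nzd_init_of_generated => // n.
have v0 : v n.+1 = 0%N.
  apply: (@vanishing_defects (colength K) S v (length (adjoin K x) setT) (maxn N N') e0 e1) => //.
  - by move=> i; have [] := defect i.
  - move=> i; rewrite geq_max => /andP[_ N'i]; rewrite /v.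
    rewrite (_ : add_scaled _ _ _ = add_fil K i.+1) ?length_self //.
    by apply/seteqP; split; [exact: add_scaled_fil_sub|exact: gen].
  - by move=> i; rewrite geq_max => /andP[Ni _]; apply: SN.
apply: length_eq0 => //; first by have [] := defect n.+1.
  exact: add_scaledP.
exact: add_scaled_fil_sub.
Qed.

Lemma rees_unit_differences : unit_differences (fun i => rees_const F (u i)).
Proof.
move=> i j /hu[c c1]; exists (rees_const F c); apply: rees_val_inj.
by rewrite /= expr0 !alg_polyC -polyCB -polyCM c1.
Qed.

(** The generic [x] need not begin either of the given sequences, so [depth_ge_exchange] is used
    twice, in [R] and in the Rees algebra. *)
Lemma exists_regular_step K r : is_ideal K ->
    depth_ge m K r.+2 -> depth_ge MR (init K) r.+1 ->
  exists x (Fx : F 1%N x), [/\ nzd_mod (init K) (rees_mono Fx),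
    depth_ge m (adjoin K x) r.+1 & depth_ge MR (init (adjoin K x)) r].
Proof.
move=> hK Kdepth inK; have hin := init_idealP F hK.
have [|x [Fx [xK xin]]] := @exists_generic R m I F hR hIi hIm u hu K setT hK
    (@is_idealT _) (depth_ge_socle_free Kdepth).
  by move=> a _; apply: depth_ge_socle_free inK a.
have xreg : nzd_mod (init K) (rees_mono Fx) by move=> p; apply: xin.
exists x, Fx; split=> //.
  apply: (depth_ge_exchange (noetherian_acc hR) hu (local_ideal hm)) => //.
  exact: fil1_sub_max.
rewrite (init_adjoin hK xreg).
apply: (depth_ge_exchange (rees_acc hR hIi (F := F)) rees_unit_differences) => //.
  exact: rees_maxP.
exact: rees_mono1_max.
Qed.

Lemma depth_init_induction j K (e : nat -> int) : is_ideal K -> e 2%N = 0 ->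
    depth_ge m K j.+2 -> depth_ge MR (init K) j.+1 ->
    (exists N, forall n, (N <= n)%N -> (colength K n)%:Z =
      \sum_(i < j.+3) (-1) ^+ i * e i * ('C(n + j.+2 - 1 - i, j.+2 - i))%:Z) ->
  depth_ge MR (init K) j.+2.
Proof.
elim: j K => [|j IHj] K hK e2 Kdepth inK [N LN];
  have [x [Fx [xreg Kx inKx]]] := exists_regular_step hK Kdepth inK;
  exists (rees_mono Fx); split=> //; try exact: rees_mono1_max;
  rewrite -(init_adjoin hK xreg).
(* In dimension two the Hilbert function of [K] itself serves as [S]; its backward difference is the
   Hilbert function of [K + xR]. *)
- apply: (@depth_init_dim1 (adjoin K x) (colength K) N (e 0%N) (e 1%N)) => //.
  + exact: adjoinP.
  + by rewrite /colength add_fil0 // length_self.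
  + by move=> n; rewrite (colength_adjoin n hK xreg) addnC.
  + move=> n Nn; rewrite LN // !big_ord_recr big_ord0 /= e2.
    have -> : (n + 2 - 1 - 0)%N = n.+1 by lia.
    have -> : (n + 2 - 1 - 1)%N = n by lia.
    by rewrite bin1; ring.
- apply: IHj => //; first exact: adjoinP.
  exists N.+1 => -[//|n]; rewrite ltnS => Nn.
  rewrite -binomial_sum_diff -!LN ?leqW //.
  by rewrite (colength_adjoin n hK xreg) PoszD; ring.
Qed.

End Depth.

(** ** Transfer to the associated graded ring *)

Section QuotientDepth.
Variables (A : comPzRingType) (J : ideal A) (M : set A) (M' : set (qring J)).
Hypothesis MM' : forall x, M x <-> M' (qpi J x).

(** Allows the depth of the graded ring to be computed upstairs in the Rees algebra, by preimages of
    ideals. *)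
Lemma depth_ge_qring (I : set (qring J)) r :
  depth_ge M' I r <-> depth_ge M (qpi J @^-1` I) r.
Proof.
have pre (L : set (qring J)) f :
    qpi J @^-1` (adjoin L (qpi J f)) = adjoin (qpi J @^-1` L) f.
  apply/seteqP; split=> x.
    move=> [a [b [La _ ex]]]; exists (x - f * repr b), (repr b); split=> //; last by ring.
    by rewrite /= qpiB qpiM qpi_repr ex addrK.
  by move=> [a [b [La _ ->]]]; exists (qpi J a), (qpi J b); rewrite -[_ * qpi J b]qpiM -qpiD.
elim: r I => [//|r IHr] I; split=> [[f [Mf fI fd]]|[f [Mf fI fd]]].
  exists (repr f); split; first by apply/MM'; rewrite qpi_repr.
    by move=> y /=; rewrite qpiM qpi_repr; apply: fI.
  by rewrite -pre qpi_repr; apply/IHr.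
exists (qpi J f); split; first exact/MM'.
  by move=> y; rewrite -[y]qpi_repr -[_ * _]qpiM; apply: fI.
by apply/IHr; rewrite pre.
Qed.

End QuotientDepth.

Theorem proposition1p5 (R : comNzRingType) (m : ideal R) (d : nat)
    (hCM : cohen_macaulay_local (ideal_set m))
    (hdim : has_krull_dim R d) (hd : (2 <= d)%N)
    (hres : infinite_set [set: qring m])
    (I : set R) (hI : primary_ideal I) (hIm : radical I = ideal_set m)
    (F : admissible_filtration I)
    (e : nat -> int) (he : hilbert_coefficients F d e)
    (M : set (assoc_graded F)) (hM : maximal_homogeneous_ideal M) :
  e 2%N = 0 -> ~ has_depth M (d - 1)%N.
Proof.
move=> e2 [[s [sreg sM ss]] depth_le].
have [hR hloc [d' hdim' [[t [treg tm td']] _]]] := hCM.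
have hmax : maximal_ideal (ideal_set m) by case: hloc.
have ed : d' = d by apply: is_max_unique hdim' hdim.
have eM : M = gr_max (F := F) (ideal_set m) by apply/(maximal_homogeneousP hmax hI hIm).
have [u hu] := residue_units (noetherian_acc hR) hloc hres.
have [hIi _ _] := hI.
have {}he : exists N, forall n : nat, (N <= n)%N -> finite_length (F n) setT /\
    (length (F n) setT)%:Z =
      \sum_(i < d.+1) (-1) ^+ i * e i * ('C(n + d - 1 - i, d - i))%:Z.
  have [N heN] := he; exists N => n /heN[l /has_length_between hl el].
  by split; [exists l|rewrite (length_unique hl)].
have [N heN] := he.
(* The Hilbert polynomial provides finite length for large [n]; smaller [n] follow because the
   filtration decreases. *)
have fl (n : nat) : finite_length (F n) setT.
  have [fl _] := heN (maxn n N) (leq_maxr _ _).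
  by apply: (finite_length_sub fl) => //; [exact: filP|apply: fil_le; exact: leq_maxl].
(* The degree-zero coefficient of a class is determined modulo [I_1], which lies in [m]. *)
have Mmax (p : rees F) : rees_max (ideal_set m) p <-> M (gr_class p).
  rewrite eM; split=> [mp|[q mq /gr_class_eq/(_ 0%N)]]; first by exists p.
  rewrite coefB => /(ideal_of_fil1 hIm hI) mqp.
  have hm' := local_ideal hloc; rewrite /rees_max /=.
  have -> : (rees_val p)`_0 = (rees_val q)`_0 - ((rees_val q)`_0 - (rees_val p)`_0) by ring.
  exact: (ideal_sub hm').
have M_ideal : is_ideal M by have [[]] := hM.
have MT : M <> setT by have [] := hM.
have e0 : @gr_class _ _ F @^-1` [set 0] = init_ideal (F := F) [set 0].
  rewrite init_ideal0; apply/seteqP; split=> p /=.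
    by rewrite -gr_class0 => /gr_class_eq; rewrite subr0.
  by move=> Fp; rewrite -gr_class0; apply/gr_class_eq; rewrite subr0.
have h0 : is_ideal [set 0 : R] by rewrite -gen_ideal_nil; apply: gen_idealP.
have F0 (n : nat) : add_fil F [set 0] n = F n.
  apply/seteqP; split=> x; last by apply: fil_sub_add_fil.
  by move=> [_ [b [-> Fb ->]]]; rewrite add0r.
have ej : d = (d - 2).+2 by lia.
have Rdepth : depth_ge m [set 0] (d - 2).+2.
  by rewrite -ej -ed -td'; apply: regular_sequence_depth_ge.
have Gdepth : depth_ge (rees_max (F := F) (ideal_set m)) (init_ideal (F := F) [set 0]) (d - 2).+1.
  rewrite -e0; apply/(depth_ge_qring Mmax).
  have -> : (d - 2).+1 = size s by rewrite ss; lia.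
  exact: regular_sequence_depth_ge.
have Gdepth' : depth_ge (rees_max (F := F) (ideal_set m)) (init_ideal (F := F) [set 0]) d.
  rewrite ej; apply: (depth_init_induction hR hloc hI hIm fl hu h0 e2 Rdepth Gdepth).
  by exists N => n /heN[_]; rewrite -ej /colength F0.
move: Gdepth'; rewrite -e0 => /(depth_ge_qring Mmax)/(depth_ge_regular_sequence M_ideal MT).
by move=> /depth_le; rewrite leEnat; lia.
Qed.
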